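(* Let $L_1,L_2,L_3>0$, $k_{ap}>0$, $k_{ad}>0$ be given, and let $f\in\mathcal F$ (the class with constants $L_1,L_2,L_3$). Consider the closed-loop system consisting of the plant $$\dot x_1=x_2,\qquad \dot x_2=f(x_1,x_2,t)+u(t),$$ the observer $$\dot\xi=-\omega_o\xi-\omega_o^2x_2-\omega_o u,\quad \xi(0)=-\omega_o x_2(0),\qquad \hat f=\xi+\omega_o x_2,$$ and the control law $$u=-k_{ap}(x_1-r)-k_{ad}(x_2-\dot r)-\hat f+\ddot r .$$ Let $e(t)=r(t)-x_1(t)$ and $e_f(t)=\hat f(t)-f(x_1(t),x_2(t),t)$. Then there exist positive constants $\eta_1,\eta_2$, which depend on $(e_f(0),k_{ap},k_{ad},L_1,L_2,L_3,\dot r,\ddot r)$, such that for all $\omega_o>\omega_o^*$ (with $\omega_o^*=\omega_o^*(L_1,L_2,k_{ap},k_{ad})$ the explicit constant defined in the context), $$|\ddot e(t)+k_{ad}\dot e(t)+k_{ap}e(t)|=|e_f(t)|\le \eta_1e^{-\omega_o t}+\frac{\eta_2}{\omega_o},\qquad t\ge 0 .$$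
   Context: Reference signal: $y^*(t)$ is a given bounded, twice differentiable real signal on $[0,\infty)$ with $\lim_{t\to\infty}y^*(t)=y^{**}$ (a constant), $\lim_{t\to\infty}\dot y^*(t)=0$, $\lim_{t\to\infty}\ddot y^*(t)=0$. Desired transient process: $r$ is the solution of the stable linear filter $\ddot r=-2c_r\dot r-c_r^2(r-y^*(t))$, $r(0)=x_1(0)$, $\dot r(0)=x_2(0)$, with a parameter $c_r>0$. The initial value $(x_1(0),x_2(0))\in\mathbb R^2$ is arbitrary. Note that $\hat f(0)=0$, so $e_f(0)=-f(x_1(0),x_2(0),0)$ does not depend on $\omega_o$. Function class: for positive constants $L_1,L_2,L_3$, $$\mathcal F=\Big\{f\in C^1(\mathbb R^2\times\mathbb R^+)\ \Big|\ f(x_1,x_2,t)=h(x_1,x_2)+w(t),\ \Big|\tfrac{\partial h}{\partial x_1}\Big|\le L_1,\ \Big|\tfrac{\partial h}{\partial x_2}\Big|\le L_2,\ |w(t)|\le L_3,\ |\dot w(t)|\le L_3,\ \lim_{t\to\infty}w(t)\text{ exists},\ \forall x_1,x_2\in\mathbb R,\ \forall t\in\mathbb R^+\Big\},$$ where $C^1(\mathbb R^2\times\mathbb R^+)$ denotes the functions $\mathbb R^2\times\mathbb R^+\to\mathbb R$ that are continuous in $(x_1,x_2)$ and $t$, with continuous partial derivatives with respect to $(x_1,x_2)$. The constant $\omega_o^*$: let $$\Omega=\{\omega\in\mathbb R \mid n_0\omega^4+n_1\omega^3+n_2\omega^2+n_3\omega+n_4=0\},$$ with $n_0=k_{ad}^2$,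 $n_1=2k_{ad}[k_{ad}(k_{ad}-L_2)-L_1]$, $n_2=2k_{ad}(k_{ap}-L_1)(k_{ad}-L_2)+[k_{ad}(k_{ad}-L_2)-L_1]^2-L_2^2k_{ap}$, $n_3=2[k_{ad}(k_{ad}-L_2)-L_1](k_{ap}-L_1)(k_{ad}-L_2)-L_2^2k_{ap}(k_{ad}-L_2)$, $n_4=(k_{ap}-L_1)^2(k_{ad}-L_2)^2$. Put $\bar\omega_o=0$ if $\Omega=\varnothing$ or $\max\Omega\le 0$, and $\bar\omega_o=\max\Omega$ if $\max\Omega>0$. Then $$\omega_o^*=\max\Big\{0,\ \frac{L_1-k_{ap}}{k_{ad}},\ L_2-k_{ad},\ \bar\omega_o\Big\}.$$ *)

(* Defs.v *)
(* Stdlib reals with Coquelicot. *)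
From Stdlib Require Export Reals.
From Stdlib Require Import Lra Psatz Classical.
From Coquelicot Require Export Coquelicot.
Open Scope R_scope.

Definition Rplus0 (t : R) : Prop := 0 <= t.

(* Signals live on [0,oo) but are typed R -> R; their values at negative times
   are never used, and the derivative at t = 0 is the one-sided one. *)
Definition deriv_nonneg (g g' : R -> R) : Prop :=
  forall t, 0 <= t -> D_in g g' Rplus0 t.

Record reference_signal (y : R -> R) : Prop := {
  ref_bounded : exists M, forall t, 0 <= t -> Rabs (y t) <= M;
  ref_limits : exists (dy ddy : R -> R) (yinf : R),
    deriv_nonneg y dy /\ deriv_nonneg dy ddy /\
    is_lim y p_infty yinf /\ is_lim dy p_infty 0 /\ is_lim ddy p_infty 0 }.

Record transient_process (cr : R) (y : R -> R) (x10 x20 : R)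
    (r dr ddr : R -> R) : Prop := {
  tp_dr : deriv_nonneg r dr;
  tp_ddr : deriv_nonneg dr ddr;
  tp_filter : forall t, 0 <= t ->
    ddr t = - 2 * cr * dr t - cr ^ 2 * (r t - y t);
  tp_init_r : r 0 = x10;
  tp_init_dr : dr 0 = x20 }.

(* Points of R^2 x [0,oo) are nested pairs ((x1, x2), t). *)
Definition cont_nonneg (g : R -> R -> R -> R) : Prop :=
  continuous_on (fun p : R * R * R => 0 <= snd p)
    (fun p : R * R * R => g (fst (fst p)) (snd (fst p)) (snd p)).

Record C1_nonneg (f : R -> R -> R -> R) : Prop := {
  C1_cont : cont_nonneg f;
  C1_ex1 : forall x1 x2 t, 0 <= t -> ex_derive (fun s => f s x2 t) x1;
  C1_ex2 : forall x1 x2 t, 0 <= t -> ex_derive (fun s => f x1 s t) x2;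
  C1_cont1 : cont_nonneg (fun x1 x2 t => Derive (fun s => f s x2 t) x1);
  C1_cont2 : cont_nonneg (fun x1 x2 t => Derive (fun s => f x1 s t) x2) }.

(* The partial derivatives of h exist because h differs from f(., ., 0) by a
   constant, so Derive has its intended meaning below. *)
Definition class_F (L1 L2 L3 : R) (f : R -> R -> R -> R) : Prop :=
  C1_nonneg f /\
  exists (h : R -> R -> R) (w dw : R -> R),
    (forall x1 x2 t, 0 <= t -> f x1 x2 t = h x1 x2 + w t) /\
    (forall x1 x2, Rabs (Derive (fun s => h s x2) x1) <= L1) /\
    (forall x1 x2, Rabs (Derive (fun s => h x1 s) x2) <= L2) /\
    (forall t, 0 <= t -> Rabs (w t) <= L3) /\
    deriv_nonneg w dw /\
    (forall t, 0 <= t -> Rabs (dw t) <= L3) /\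
    ex_finite_lim w p_infty.

Definition Omega (L1 L2 kap kad : R) (om : R) : Prop :=
  let n0 := kad ^ 2 in
  let n1 := 2 * kad * (kad * (kad - L2) - L1) in
  let n2 := 2 * kad * (kap - L1) * (kad - L2)
            + (kad * (kad - L2) - L1) ^ 2 - L2 ^ 2 * kap in
  let n3 := 2 * (kad * (kad - L2) - L1) * (kap - L1) * (kad - L2)
            - L2 ^ 2 * kap * (kad - L2) in
  let n4 := (kap - L1) ^ 2 * (kad - L2) ^ 2 in
  n0 * om ^ 4 + n1 * om ^ 3 + n2 * om ^ 2 + n3 * om + n4 = 0.

Definition is_max (E : R -> Prop) (m : R) : Prop := E m /\ is_upper_bound E m.

(* The supremum of a nonempty Omega is its maximum, and it is -oo, which [real]
   sends to 0, when Omega is empty; see [omega_bar_empty] and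
   [omega_bar_max]. *)
Definition omega_bar (L1 L2 kap kad : R) : R :=
  Rmax 0 (real (Lub_Rbar (Omega L1 L2 kap kad))).

Definition omega_star (L1 L2 kap kad : R) : R :=
  Rmax 0 (Rmax ((L1 - kap) / kad)
               (Rmax (L2 - kad) (omega_bar L1 L2 kap kad))).

Definition f_hat (om : R) (x2 xi : R -> R) (t : R) : R := xi t + om * x2 t.

Definition control (om kap kad : R) (r dr ddr x1 x2 xi : R -> R) (t : R) : R :=
  - kap * (x1 t - r t) - kad * (x2 t - dr t) - f_hat om x2 xi t + ddr t.

Record closed_loop (f : R -> R -> R -> R) (om kap kad : R)
    (r dr ddr x1 x2 xi : R -> R) : Prop := {
  cl_x1 : deriv_nonneg x1 x2;
  cl_x2 : deriv_nonneg x2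
    (fun t => f (x1 t) (x2 t) t + control om kap kad r dr ddr x1 x2 xi t);
  cl_xi : deriv_nonneg xi
    (fun t => - om * xi t - om ^ 2 * x2 t
              - om * control om kap kad r dr ddr x1 x2 xi t);
  cl_xi0 : xi 0 = - om * x2 0 }.

Definition err (r x1 : R -> R) (t : R) : R := r t - x1 t.

Definition err_f (f : R -> R -> R -> R) (om : R) (x1 x2 xi : R -> R) (t : R) : R :=
  f_hat om x2 xi t - f (x1 t) (x2 t) t.

Lemma omega_bar_empty L1 L2 kap kad :
  (forall om, ~ Omega L1 L2 kap kad om) -> omega_bar L1 L2 kap kad = 0.
Proof.
intros H; unfold omega_bar.
rewrite (is_lub_Rbar_unique _ m_infty); [apply Rmax_left; simpl; lra|].
split; [intros x Hx; now elim (H x)|intros b _; now destruct b].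
Qed.

Lemma Omega_has_max L1 L2 kap kad : 0 < kad ->
  (exists om, Omega L1 L2 kap kad om) -> exists m, is_max (Omega L1 L2 kap kad) m.
Proof.
intros Hk [w0 Hw0]; unfold is_max, Omega in *; cbv zeta in *.
set (n0 := kad ^ 2) in *.
set (n1 := 2 * kad * (kad * (kad - L2) - L1)) in *.
set (n2 := 2 * kad * (kap - L1) * (kad - L2) + _ - _) in *.
set (n3 := 2 * (kad * (kad - L2) - L1) * (kap - L1) * (kad - L2) - _) in *.
set (n4 := (kap - L1) ^ 2 * (kad - L2) ^ 2) in *.
assert (H0 : 0 < n0) by (unfold n0; nra).
clearbody n0 n1 n2 n3 n4.
set (p := fun x => n0 * x ^ 4 + n1 * x ^ 3 + n2 * x ^ 2 + n3 * x + n4).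
set (B := 1 + (Rabs n1 + Rabs n2 + Rabs n3 + Rabs n4) / n0).
assert (HB : is_upper_bound (fun x => p x = 0) B).
{ intros x Hx; apply Rnot_lt_le; intros Hlt.
  pose proof (Rabs_pos n1); pose proof (Rabs_pos n2).
  pose proof (Rabs_pos n3); pose proof (Rabs_pos n4).
  assert (0 <= (Rabs n1 + Rabs n2 + Rabs n3 + Rabs n4) / n0).
  { apply Rmult_le_pos; [lra|left; now apply Rinv_0_lt_compat]. }
  assert (Hx1 : 1 < x) by (unfold B in Hlt; lra).
  assert (HnB : n0 + (Rabs n1 + Rabs n2 + Rabs n3 + Rabs n4) < n0 * x).
  { replace (n0 + _) with (n0 * B) by (unfold B; field; lra).
    now apply Rmult_lt_compat_l. }
  assert (G : forall c, - Rabs c <= c).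
  { intros c; pose proof (Rle_abs (- c)); rewrite Rabs_Ropp in *; lra. }
  pose proof (G n1); pose proof (G n2); pose proof (G n3); pose proof (G n4).
  assert (x <= x ^ 2) by nra. assert (x ^ 2 <= x ^ 3) by nra.
  assert (0 < x ^ 3) by nra.
  assert (n0 * x ^ 4 = n0 * x * x ^ 3) by ring.
  assert ((n0 + (Rabs n1 + Rabs n2 + Rabs n3 + Rabs n4)) * x ^ 3
          < n0 * x * x ^ 3) by now apply Rmult_lt_compat_r.
  assert (- Rabs n1 * x ^ 3 <= n1 * x ^ 3) by nra.
  assert (- Rabs n2 * x ^ 3 <= n2 * x ^ 2) by nra.
  assert (- Rabs n3 * x ^ 3 <= n3 * x) by nra.
  assert (- Rabs n4 * x ^ 3 <= n4) by nra.
  assert (0 < n0 * x ^ 3) by nra.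
  unfold p in Hx; nra. }
destruct (completeness (fun x => p x = 0)) as [m [Hm1 Hm2]];
  [now exists B|now exists w0|].
exists m; split; [|exact Hm1].
apply NNPP; intros Hpm; fold (p m) in Hpm.
assert (Hc : continuity_pt p m).
{ apply derivable_continuous_pt; unfold p; reg. }
destruct (Hc (Rabs (p m))) as [d [Hd Hd']]; [now apply Rabs_pos_lt|].
assert (m <= m - d); [|lra].
apply Hm2; intros x Hx; apply Rnot_lt_le; intros Hlt.
assert (Hxm := Hm1 x Hx).
destruct (Req_dec x m) as [->|Hne]; [now apply Hpm|].
assert (A := Hd' x); simpl in A; unfold R_dist in A.
rewrite Hx, Rminus_0_l, Rabs_Ropp in A.
apply (Rlt_irrefl (Rabs (p m))), A.
repeat split; [now apply not_eq_sym|].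
apply Rabs_def1; lra.
Qed.

Lemma omega_bar_max L1 L2 kap kad m :
  is_max (Omega L1 L2 kap kad) m -> omega_bar L1 L2 kap kad = Rmax 0 m.
Proof.
intros [H1 H2]; unfold omega_bar.
rewrite (is_lub_Rbar_unique _ m); [reflexivity|].
split; [intros x Hx; now apply H2|intros b Hb; now apply Hb].
Qed.

(* Main.v *)
Require Import Defs.
From Stdlib Require Import Lra Psatz Classical.

(** Write [e = r - x1], [v = dr - x2] and [q] for the estimation error.  Then
[e' = v] and [v' = q - kad v - kap e], which is the claimed equality, and the
observer gives [f_hat' = - om q].  Since [f] is Lipschitz, [q' = - om q] up to an
error proportional to the size of the state plus a constant.  Once the state is
known to be bounded uniformly in [om], the estimate
[Rabs (q t) <= eta1 exp (- om t) + eta2 / om] follows.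

For large [om] this boundedness is a small perturbation argument
([high_gain_bound]).  For [om] in a bounded range above [omega_star] the term
[eta2 / om] alone suffices, but it has to hold uniformly up to [omega_star],
including the case [omega_star = 0] ([moderate_gain_bound]).  There the observer
is integrated explicitly, and the loop becomes a PID loop
[v' = - kd v - kp e - W - F - (increment of h)], [W' = kap om e], with
[kd = om + kad], [kp = kad om + kap] and a bounded forcing [F], the uncertainty
along the reference.  Its Lyapunov function is
[v^2 / 2 + mu e v + (c + kp) e^2 / 2 + W e + mu W^2 / (2 kap om)]
plus the potential energy of the nonlinearity and a small multiple of [W v].
The potential energy makes the position slope enter only through its lower
bound [B = kad om + kap - L1].  The velocity slope enters through a cross term,
and dissipation for all slopes requires, with [A = om + kad - L2] and
[g = kap om], some [mu] such that [L2^2 mu^2 <= 4 (A - mu) (mu B - g)].  Such a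
[mu] exists in [(g / B, A)] exactly when [A B - g >= L2 sqrt (g A)]
([multiplier_exists]), and this is what [om > omega_star] guarantees: the quartic
of [Omega] is
[(A B - g)^2 - L2^2 g A] ([above_omega_star]).

At [om = omega_star] this condition may degenerate to an equality.  Uniformity
survives because the velocity slope is worst at one end of its range only, so
that shifting the centre of the cross term slightly ([form_margin]) leaves a
strict margin, and because [A] and [B] stay positive at [omega_star]
([omega_star_nondegenerate]).  When [om] tends to [0] the weight of [W^2] blows up
like [1 / om], which the term [eta2 / om] allows. *)

(** * Derivatives with an error bar and comparison *)

(** [g] has derivative [d] at [t] up to an error [k]: every derived number of [g]
at [t] lies in [[d - k, d + k]].  For a Lipschitz function [h] the signal
[h (x1 t) (x2 t)] need not be differentiable, but it has a derivative in this
sense, with [d = 0] and an explicit [k].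
Sums and products behave as for derivatives, and only times [s >= 0] enter,
which makes the one-sided derivative at [0] an ordinary case. *)
Definition deriv_within (g : R -> R) (t d k : R) : Prop :=
  forall eps, 0 < eps -> exists delta, 0 < delta /\
    forall s, 0 <= s -> Rabs (s - t) < delta ->
      Rabs (g s - g t - d * (s - t)) <= (k + eps) * Rabs (s - t).

Lemma deriv_within_weaken g t d k d' k' :
  deriv_within g t d k -> Rabs (d - d') + k <= k' -> deriv_within g t d' k'.
Proof.
intros H Hk eps Heps; destruct (H eps Heps) as [de [Hde H']].
exists de; split; [exact Hde|]; intros s Hs Hst.
specialize (H' s Hs Hst).
replace (g s - g t - d' * (s - t))
  with ((g s - g t - d * (s - t)) + (d - d') * (s - t)) by ring.
eapply Rle_trans; [apply Rabs_triang|]; rewrite Rabs_mult.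
pose proof (Rabs_pos (s - t)); nra.
Qed.

Lemma deriv_within_ext f g t d k :
  (forall s, 0 <= s -> f s = g s) -> 0 <= t ->
  deriv_within f t d k -> deriv_within g t d k.
Proof.
intros E Ht H eps Heps; destruct (H eps Heps) as [de [Hde H']].
exists de; split; [exact Hde|]; intros s Hs Hst.
rewrite <- !E by assumption; now apply H'.
Qed.

Lemma deriv_within_of_deriv g g' t :
  deriv_nonneg g g' -> 0 <= t -> deriv_within g t (g' t) 0.
Proof.
intros H Ht eps Heps.
destruct (H t Ht eps Heps) as [de [Hde H']].
exists de; split; [exact Hde|]; intros s Hs Hst.
destruct (Req_dec s t) as [->|Hne].
- rewrite !Rminus_diag, Rmult_0_r, Rminus_diag, Rabs_R0; lra.
- assert (A : Rabs ((g s - g t) / (s - t) - g' t) < eps).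
  { apply (H' s); split; [split; [exact Hs|now apply not_eq_sym]|exact Hst]. }
  replace (g s - g t - g' t * (s - t))
    with (((g s - g t) / (s - t) - g' t) * (s - t)) by (field; lra).
  rewrite Rabs_mult, Rplus_0_l; apply Rmult_le_compat_r; [apply Rabs_pos|lra].
Qed.

Lemma deriv_within_plus f g t df dg kf kg :
  deriv_within f t df kf -> deriv_within g t dg kg ->
  deriv_within (fun s => f s + g s) t (df + dg) (kf + kg).
Proof.
intros Hf Hg eps Heps.
destruct (Hf (eps / 2)) as [d1 [Hd1 H1]]; [lra|].
destruct (Hg (eps / 2)) as [d2 [Hd2 H2]]; [lra|].
exists (Rmin d1 d2); split; [now apply Rmin_glb_lt|]; intros s Hs Hst.
specialize (H1 s Hs (Rlt_le_trans _ _ _ Hst (Rmin_l _ _))).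
specialize (H2 s Hs (Rlt_le_trans _ _ _ Hst (Rmin_r _ _))).
replace (f s + g s - (f t + g t) - (df + dg) * (s - t))
  with ((f s - f t - df * (s - t)) + (g s - g t - dg * (s - t))) by ring.
eapply Rle_trans; [apply Rabs_triang|]; lra.
Qed.

Lemma deriv_within_scal c f t df kf :
  deriv_within f t df kf ->
  deriv_within (fun s => c * f s) t (c * df) (Rabs c * kf).
Proof.
intros Hf eps Heps; pose proof (Rabs_pos c) as Hc.
destruct (Hf (eps / (Rabs c + 1))) as [de [Hde H]].
{ apply Rdiv_lt_0_compat; lra. }
exists de; split; [exact Hde|]; intros s Hs Hst; specialize (H s Hs Hst).
replace (c * f s - c * f t - c * df * (s - t))
  with (c * (f s - f t - df * (s - t))) by ring.
rewrite Rabs_mult.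
apply Rle_trans with (Rabs c * ((kf + eps / (Rabs c + 1)) * Rabs (s - t))).
{ now apply Rmult_le_compat_l. }
assert (Rabs c * (eps / (Rabs c + 1)) <= eps).
{ apply Rmult_le_reg_r with (Rabs c + 1); [lra|].
  replace (Rabs c * (eps / (Rabs c + 1)) * (Rabs c + 1))
    with (Rabs c * eps) by (field; lra); nra. }
pose proof (Rabs_pos (s - t)); nra.
Qed.

Lemma deriv_within_lipschitz g t d k :
  deriv_within g t d k -> exists delta, 0 < delta /\
    forall s, 0 <= s -> Rabs (s - t) < delta ->
      Rabs (g s - g t) <= (Rabs d + Rabs k + 1) * Rabs (s - t).
Proof.
intros H; destruct (H 1 Rlt_0_1) as [de [Hde H']].
exists de; split; [exact Hde|]; intros s Hs Hst; specialize (H' s Hs Hst).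
replace (g s - g t) with ((g s - g t - d * (s - t)) + d * (s - t)) by ring.
eapply Rle_trans; [apply Rabs_triang|]; rewrite Rabs_mult.
pose proof (Rabs_pos (s - t)); pose proof (Rle_abs k); nra.
Qed.

Lemma deriv_within_cont g t d k :
  deriv_within g t d k -> forall eps, 0 < eps -> exists delta, 0 < delta /\
    forall s, 0 <= s -> Rabs (s - t) < delta -> Rabs (g s - g t) < eps.
Proof.
intros H eps Heps; destruct (deriv_within_lipschitz _ _ _ _ H) as [de [Hde H']].
set (L := Rabs d + Rabs k + 1) in *.
assert (HL : 0 < L) by (unfold L; pose proof (Rabs_pos d); pose proof (Rabs_pos k); lra).
exists (Rmin de (eps / L)); split.
{ apply Rmin_glb_lt; [lra|now apply Rdiv_lt_0_compat]. }
intros s Hs Hst.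
apply Rle_lt_trans with (L * Rabs (s - t)).
{ apply H'; [exact Hs|eapply Rlt_le_trans; [exact Hst|apply Rmin_l]]. }
apply Rlt_le_trans with (L * (eps / L)).
{ apply Rmult_lt_compat_l; [exact HL|eapply Rlt_le_trans; [exact Hst|apply Rmin_r]]. }
right; field; lra.
Qed.

Lemma deriv_within_mult f g t df dg kf kg :
  deriv_within f t df kf -> deriv_within g t dg kg ->
  deriv_within (fun s => f s * g s) t
    (df * g t + f t * dg) (kf * Rabs (g t) + Rabs (f t) * kg).
Proof.
intros Hf Hg eps Heps.
pose proof (Rabs_pos (g t)) as Pg; pose proof (Rabs_pos (f t)) as Pf.
set (e1 := eps / 3 / (Rabs (g t) + Rabs (f t) + 1)).
assert (He1 : 0 < e1) by (unfold e1; apply Rdiv_lt_0_compat; lra).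
assert (He2 : e1 * (Rabs (g t) + Rabs (f t) + 1) = eps / 3)
  by (unfold e1; field; lra).
destruct (Hf e1 He1) as [d1 [Hd1 H1]].
destruct (Hg e1 He1) as [d2 [Hd2 H2]].
destruct (deriv_within_lipschitz _ _ _ _ Hf) as [d3 [Hd3 H3]].
set (Lf := Rabs df + Rabs kf + 1) in *.
assert (HLf : 0 < Lf)
  by (unfold Lf; pose proof (Rabs_pos df); pose proof (Rabs_pos kf); lra).
destruct (deriv_within_cont _ _ _ _ Hg (eps / 3 / Lf)) as [d4 [Hd4 H4]].
{ apply Rdiv_lt_0_compat; lra. }
exists (Rmin (Rmin d1 d2) (Rmin d3 d4)); split; [now repeat apply Rmin_glb_lt|].
intros s Hs Hst.
pose proof (Rmin_l (Rmin d1 d2) (Rmin d3 d4)).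
pose proof (Rmin_r (Rmin d1 d2) (Rmin d3 d4)).
pose proof (Rmin_l d1 d2); pose proof (Rmin_r d1 d2).
pose proof (Rmin_l d3 d4); pose proof (Rmin_r d3 d4).
assert (A1 := H1 s Hs ltac:(lra)); assert (A2 := H2 s Hs ltac:(lra)).
assert (A3 := H3 s Hs ltac:(lra)); assert (A4 := H4 s Hs ltac:(lra)).
replace (f s * g s - f t * g t - (df * g t + f t * dg) * (s - t))
  with ((f s - f t - df * (s - t)) * g t + f t * (g s - g t - dg * (s - t))
        + (f s - f t) * (g s - g t)) by ring.
eapply Rle_trans; [apply Rabs_triang|].
eapply Rle_trans; [apply Rplus_le_compat_r, Rabs_triang|].
rewrite !Rabs_mult.
set (x := Rabs (s - t)) in *; assert (Px : 0 <= x) by apply Rabs_pos.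
assert (B1 : Rabs (f s - f t - df * (s - t)) * Rabs (g t)
             <= (kf + e1) * x * Rabs (g t)) by now apply Rmult_le_compat_r.
assert (B2 : Rabs (f t) * Rabs (g s - g t - dg * (s - t))
             <= Rabs (f t) * ((kg + e1) * x)) by now apply Rmult_le_compat_l.
assert (B3 : Rabs (f s - f t) * Rabs (g s - g t) <= Lf * x * (eps / 3 / Lf)).
{ apply Rmult_le_compat; try apply Rabs_pos; lra. }
replace (Lf * x * (eps / 3 / Lf)) with (eps / 3 * x) in B3 by (field; lra).
assert (e1 * x * (Rabs (g t) + Rabs (f t) + 1) = eps / 3 * x)
  by (rewrite <- He2; ring).
assert (0 <= e1 * x) by nra.
nra.
Qed.

Lemma deriv_within_of_derive g t d : is_derive g t d -> deriv_within g t d 0.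
Proof.
intros H eps Heps.
destruct (proj1 (is_derive_Reals _ _ _) H eps Heps) as [de H'].
exists de; split; [apply cond_pos|]; intros s Hs Hst.
destruct (Req_dec s t) as [->|Hne].
- rewrite !Rminus_diag, Rmult_0_r, Rminus_diag, Rabs_R0; lra.
- specialize (H' (s - t) ltac:(lra) Hst).
  replace (t + (s - t)) with s in H' by ring.
  replace (g s - g t - d * (s - t))
    with (((g s - g t) / (s - t) - d) * (s - t)) by (field; lra).
  rewrite Rabs_mult, Rplus_0_l; apply Rmult_le_compat_r; [apply Rabs_pos|lra].
Qed.

(** At the last time before an excursion above [M] the signal equals [M], and its
derived numbers there are negative, so it cannot rise.  [U] will be a Lyapunov
function, or the distance to the solution of a comparison equation. *)
Lemma barrier U M :
  U 0 <= M ->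
  (forall t, 0 <= t -> exists d k,
     deriv_within U t d k /\ (U t = M -> d + k < 0)) ->
  forall t, 0 <= t -> U t <= M.
Proof.
intros H0 HU T HT; apply Rnot_lt_le; intros Hlt.
(* [t0] is the last time at which [U] is at most [M] before [T]. *)
destruct (completeness (fun t => 0 <= t <= T /\ U t <= M)) as [t0 [Hub Hleast]].
{ exists T; intros t [Ht _]; lra. }
{ exists 0; split; [lra|exact H0]. }
assert (Ht0 : 0 <= t0) by (apply Hub; split; [lra|exact H0]).
assert (Ht0T : t0 <= T) by (apply Hleast; intros t [Ht _]; lra).
destruct (HU t0 Ht0) as [d [k [Hd Hneg]]].
assert (Hle : U t0 <= M).
{ apply Rnot_lt_le; intros Hgt.
  destruct (deriv_within_cont _ _ _ _ Hd (U t0 - M)) as [de [Hde Hc]]; [lra|].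
  assert (t0 <= t0 - de); [|lra].
  apply Hleast; intros t [Ht Ht']; apply Rnot_lt_le; intros Hl.
  assert (t <= t0) by (apply Hub; now split).
  assert (A : Rabs (U t - U t0) < U t0 - M).
  { apply Hc; [lra|apply Rabs_def1; lra]. }
  apply Rabs_def2 in A; lra. }
assert (Hlt0 : t0 < T).
{ destruct Ht0T as [|E]; [assumption|]; subst t0; lra. }
assert (Hright : exists de, 0 < de /\
          forall s, t0 <= s < t0 + de -> U s <= M).
{ destruct Hle as [Hl|He].
  - destruct (deriv_within_cont _ _ _ _ Hd (M - U t0)) as [de [Hde Hc]]; [lra|].
    exists de; split; [exact Hde|]; intros s Hs.
    assert (A : Rabs (U s - U t0) < M - U t0).
    { apply Hc; [lra|apply Rabs_def1; lra]. }
    apply Rabs_def2 in A; lra.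
  - specialize (Hneg He).
    destruct (Hd (- (d + k))) as [de [Hde Hc]]; [lra|].
    exists de; split; [exact Hde|]; intros s Hs.
    assert (A := Hc s ltac:(lra) ltac:(apply Rabs_def1; lra)).
    rewrite (Rabs_right (s - t0)) in A by lra.
    pose proof (Rle_abs (U s - U t0 - d * (s - t0))); nra. }
destruct Hright as [de [Hde Hr]].
set (s := Rmin T (t0 + de / 2)).
assert (Hs : t0 < s <= T /\ s < t0 + de).
{ unfold s; split; [split|].
  - apply Rmin_glb_lt; lra.
  - apply Rmin_l.
  - eapply Rle_lt_trans; [apply Rmin_r|lra]. }
assert (s <= t0); [|lra].
apply Hub; split; [lra|apply Hr; lra].
Qed.

(** The barrier argument needs a strict sign, whence the slope [- e], with [e] as
small as desired. *)
Lemma nonincreasing_of_deriv_nonpos g dg :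
  deriv_nonneg g dg -> (forall s, 0 <= s -> dg s <= 0) ->
  forall t, 0 <= t -> g t <= g 0.
Proof.
intros Hg Hneg t Ht; apply le_epsilon; intros eps Heps.
set (e := eps / (t + 1)).
assert (He : 0 < e) by (apply Rdiv_lt_0_compat; lra).
assert (B : g t + - e * t <= g 0 + e).
{ apply (barrier (fun s => g s + - e * s) (g 0 + e)); [lra| |exact Ht].
  intros s Hs; exists (dg s + - e * 1), (0 + Rabs (- e) * 0); split.
  - apply deriv_within_plus; [now apply deriv_within_of_deriv|].
    apply deriv_within_scal, deriv_within_of_derive, (is_derive_id s).
  - intros _; specialize (Hneg s Hs); lra. }
assert (e * (t + 1) = eps) by (unfold e; field; lra).
lra.
Qed.

(** [Rabs (q 0) * exp (- a * t) + G / a] solves [q' = - a q + G]; raised by any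
[eps > 0] it becomes a strict barrier for [q]. *)
Lemma decay_upper q a G :
  0 < a -> 0 <= G ->
  (forall t, 0 <= t -> deriv_within q t (- a * q t) G) ->
  forall t, 0 <= t -> q t <= Rabs (q 0) * exp (- a * t) + G / a.
Proof.
intros Ha HG Hq t Ht; apply le_epsilon; intros eps Heps.
assert (HGa : 0 <= G / a) by (apply Rdiv_le_0_compat; lra).
enough (q t + - Rabs (q 0) * exp (- a * t) <= G / a + eps) by lra.
apply (barrier (fun s => q s + - Rabs (q 0) * exp (- a * s)));
  [|intros s Hs|exact Ht].
- rewrite Rmult_0_r, exp_0; pose proof (Rle_abs (q 0)); lra.
- exists (- a * q s + - Rabs (q 0) * (- a * exp (- a * s))),
    (G + Rabs (- Rabs (q 0)) * 0); split.
  + apply deriv_within_plus; [now apply Hq|].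
    apply deriv_within_scal, deriv_within_of_derive.
    auto_derive; [exact I|ring].
  + intros E.
    assert (a * (G / a) = G) by (field; lra); nra.
Qed.

Lemma decay q a G :
  0 < a -> 0 <= G ->
  (forall t, 0 <= t -> deriv_within q t (- a * q t) G) ->
  forall t, 0 <= t -> Rabs (q t) <= Rabs (q 0) * exp (- a * t) + G / a.
Proof.
intros Ha HG Hq t Ht; apply Rabs_le; split.
- assert (B := decay_upper (fun s => -1 * q s) a G Ha HG).
  cut (-1 * q t <= Rabs (-1 * q 0) * exp (- a * t) + G / a).
  { rewrite Rabs_mult, (Rabs_left (-1)) by lra; lra. }
  apply B; [|exact Ht]; intros s Hs.
  eapply deriv_within_weaken; [apply deriv_within_scal, (Hq s Hs)|].
  replace (-1 * (- a * q s) - - a * (-1 * q s)) with 0 by ring.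
  rewrite Rabs_R0, (Rabs_left (-1)); lra.
- now apply decay_upper.
Qed.

(** * Lipschitz uncertainties and their potential *)

Definition lipschitz2 (h : R -> R -> R) (L1 L2 : R) : Prop :=
  (forall a b y, Rabs (h a y - h b y) <= L1 * Rabs (a - b)) /\
  (forall a y z, Rabs (h a y - h a z) <= L2 * Rabs (y - z)).

Lemma lipschitz_of_derive_bound g L :
  (forall s, ex_derive g s) -> (forall s, Rabs (Derive g s) <= L) ->
  forall a b, Rabs (g a - g b) <= L * Rabs (a - b).
Proof.
intros Hg HL a b.
destruct (MVT_gen g b a (Derive g)) as [c [_ Hc]].
- intros x _; now apply Derive_correct.
- intros x _; apply derivable_continuous_pt, ex_derive_Reals_0, Hg.
- rewrite Hc, Rabs_mult; apply Rmult_le_compat_r; [apply Rabs_pos|apply HL].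
Qed.

(** The bounds on [Derive] carry information only where the partial derivatives
exist, and these come from the smoothness of [f] at time [0], which differs
from [h] by the constant [w 0]. *)
Lemma class_F_lipschitz L1 L2 L3 f : class_F L1 L2 L3 f ->
  exists h w dw, lipschitz2 h L1 L2 /\
    (forall x1 x2 t, 0 <= t -> f x1 x2 t = h x1 x2 + w t) /\
    (forall t, 0 <= t -> Rabs (w t) <= L3) /\
    deriv_nonneg w dw /\ (forall t, 0 <= t -> Rabs (dw t) <= L3).
Proof.
intros [HC [h [w [dw [Hf [H1 [H2 [Hw [Hdw [Hdwb _]]]]]]]]]].
exists h, w, dw; split; [|now repeat split].
assert (E : forall x1 x2, h x1 x2 = f x1 x2 0 - w 0).
{ intros x1 x2; rewrite (Hf x1 x2 0) by lra; ring. }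
split; intros.
- apply (lipschitz_of_derive_bound (fun s => h s y)); [|intros s; apply H1].
  intros s; apply ex_derive_ext with (fun s => f s y 0 - w 0);
    [intros; now rewrite E|].
  apply @ex_derive_minus; [apply (C1_ex1 _ HC); lra|apply ex_derive_const].
- apply (lipschitz_of_derive_bound (fun s => h a s)); [|intros s; apply H2].
  intros s; apply ex_derive_ext with (fun s => f a s 0 - w 0);
    [intros; now rewrite E|].
  apply @ex_derive_minus; [apply (C1_ex2 _ HC); lra|apply ex_derive_const].
Qed.

(** A primitive of [h] in the position variable, the velocity [y] being a
parameter. *)
Definition potential (h : R -> R -> R) (x y : R) : R := RInt (fun s => h s y) 0 x.

Lemma is_derive_potential h L1 L2 x y :
  lipschitz2 h L1 L2 -> is_derive (fun x => potential h x y) x (h x y).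
Proof.
intros [H _].
assert (Hc : forall z, continuous (fun s => h s y) z).
{ intros z; apply continuity_pt_filterlim; intros eps Heps.
  assert (0 < Rabs L1 + 1) by (pose proof (Rabs_pos L1); lra).
  exists (eps / (Rabs L1 + 1)); split; [now apply Rdiv_lt_0_compat|].
  intros s [_ Hs]; simpl in *; unfold Rdist in *.
  eapply Rle_lt_trans; [apply H|].
  apply Rle_lt_trans with ((Rabs L1 + 1) * Rabs (s - z)).
  { pose proof (Rle_abs L1); pose proof (Rabs_pos (s - z)); nra. }
  apply Rlt_le_trans with ((Rabs L1 + 1) * (eps / (Rabs L1 + 1))).
  { now apply Rmult_lt_compat_l. }
  right; field; lra. }
apply (is_derive_RInt (fun s => h s y) (fun x => potential h x y) 0); [|apply Hc].
apply filter_forall; intros b.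
apply (@RInt_correct R_CompleteNormedModule), ex_RInt_continuous; intros z _; apply Hc.
Qed.

(** This replaces differentiation under the integral sign in [y], for which
Lipschitz continuity of [h] would not suffice. *)
Lemma potential_param h L1 L2 a b y z : lipschitz2 h L1 L2 ->
  Rabs (potential h b y - potential h a y - (potential h b z - potential h a z))
    <= L2 * Rabs (y - z) * Rabs (b - a).
Proof.
intros H.
assert (D : forall x, is_derive (fun x => potential h x y - potential h x z) x
                        (h x y - h x z)).
{ intros x; apply @is_derive_minus; eapply is_derive_potential; apply H. }
destruct (MVT_gen (fun x => potential h x y - potential h x z) a b
            (fun x => h x y - h x z)) as [c [_ Hc]].
- intros x _; apply D.
- intros x _; apply derivable_continuous_pt; eexists; apply is_derive_Reals, D.
- replace (potential h b y - _ - _) with ((h c y - h c z) * (b - a))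
    by (simpl in Hc; rewrite <- Hc; ring).
  rewrite Rabs_mult; apply Rmult_le_compat_r; [apply Rabs_pos|apply H].
Qed.

(** The constant [L1 / 2] is the sharp one; a plain mean value estimate would give
[L1], and the quadratic form of the Lyapunov function could then fail to be
positive for gains close to [omega_star]. *)
Lemma potential_remainder_upper h L1 L2 a b y sg : lipschitz2 h L1 L2 ->
  sg = 1 \/ sg = -1 ->
  sg * (potential h b y - potential h a y - (b - a) * h b y)
    <= L1 / 2 * (b - a) ^ 2.
Proof.
intros H Hsg.
(* [k] decreases towards [b] on both sides: the quadratic term dominates [h]. *)
set (k := fun x => sg * (potential h x y - x * h b y) + L1 / 2 * (x - b) ^ 2).
set (dk := fun x => sg * (h x y - h b y) + L1 * (x - b)).
assert (D : forall x, is_derive k x (dk x)).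
{ intros x; unfold k, dk; apply @is_derive_plus.
  - apply @is_derive_scal, @is_derive_minus; [eapply is_derive_potential; apply H|].
    auto_derive; [exact I|ring].
  - auto_derive; [exact I|field]. }
destruct (MVT_gen k a b dk) as [c [Hc E]].
- intros x _; apply D.
- intros x _; apply derivable_continuous_pt; eexists; apply is_derive_Reals, D.
- assert (Hh : sg * (h c y - h b y) <= L1 * Rabs (c - b)
            /\ - (L1 * Rabs (c - b)) <= sg * (h c y - h b y)).
  { pose proof (proj1 H c b y) as Hl; apply Rabs_le_between in Hl.
    destruct Hsg as [-> | ->]; lra. }
  assert (0 <= - (dk c * (b - a)) ); [|unfold k in E; nra].
  unfold dk in *; destruct (Rle_dec a b) as [Hab|Hab].
  + rewrite Rmin_left, Rmax_right in Hc by lra.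
    rewrite Rabs_left1 in Hh by lra. nra.
  + rewrite Rmin_right, Rmax_left in Hc by lra.
    rewrite Rabs_right in Hh by lra. nra.
Qed.

(** * Variation along a trajectory *)

Lemma deriv_within_comp (G g : R -> R) (t l d : R) :
  is_derive G (g t) l -> deriv_within g t d 0 ->
  deriv_within (fun s => G (g s)) t (l * d) 0.
Proof.
intros HG Hg eps Heps.
destruct (deriv_within_lipschitz _ _ _ _ Hg) as [d1 [Hd1 H1]].
set (L := Rabs d + Rabs 0 + 1) in *.
assert (HL : 0 < L) by (unfold L; rewrite Rabs_R0; pose proof (Rabs_pos d); lra).
assert (Pl := Rabs_pos l).
destruct (proj1 (is_derive_Reals _ _ _) HG (eps / 2 / L)) as [d2 H2].
{ apply Rdiv_lt_0_compat; lra. }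
destruct (deriv_within_cont _ _ _ _ Hg d2 (cond_pos d2)) as [d3 [Hd3 H3]].
destruct (Hg (eps / 2 / (Rabs l + 1))) as [d4 [Hd4 H4]].
{ apply Rdiv_lt_0_compat; lra. }
exists (Rmin d1 (Rmin d3 d4)); split; [now repeat apply Rmin_glb_lt|].
intros s Hs Hst.
pose proof (Rmin_l d1 (Rmin d3 d4)); pose proof (Rmin_r d1 (Rmin d3 d4)).
pose proof (Rmin_l d3 d4); pose proof (Rmin_r d3 d4).
specialize (H1 s Hs ltac:(lra)); specialize (H3 s Hs ltac:(lra)).
specialize (H4 s Hs ltac:(lra)).
set (x := Rabs (s - t)) in *; assert (Px : 0 <= x) by apply Rabs_pos.
assert (A1 : Rabs (G (g s) - G (g t) - l * (g s - g t))
             <= eps / 2 / L * Rabs (g s - g t)).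
{ destruct (Req_dec (g s) (g t)) as [->|Hne].
  - rewrite !Rminus_diag, Rmult_0_r, Rminus_diag, Rabs_R0; lra.
  - specialize (H2 (g s - g t) ltac:(lra) H3).
    replace (g t + (g s - g t)) with (g s) in H2 by ring.
    replace (G (g s) - G (g t) - l * (g s - g t))
      with (((G (g s) - G (g t)) / (g s - g t) - l) * (g s - g t)) by (field; lra).
    rewrite Rabs_mult; apply Rmult_le_compat_r; [apply Rabs_pos|lra]. }
assert (A2 : eps / 2 / L * Rabs (g s - g t) <= eps / 2 * x).
{ replace (eps / 2 * x) with (eps / 2 / L * (L * x)) by (field; lra).
  apply Rmult_le_compat_l; [|exact H1].
  apply Rlt_le; apply Rdiv_lt_0_compat; lra. }
assert (A3 : Rabs l * Rabs (g s - g t - d * (s - t)) <= eps / 2 * x).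
{ apply Rle_trans with (Rabs l * (eps / 2 / (Rabs l + 1) * x)).
  - apply Rmult_le_compat_l; lra.
  - replace (eps / 2 * x) with ((Rabs l + 1) * (eps / 2 / (Rabs l + 1) * x))
      by (field; lra).
    apply Rmult_le_compat_r; [|lra].
    apply Rmult_le_pos; [|lra]; apply Rlt_le, Rdiv_lt_0_compat; lra. }
replace (G (g s) - G (g t) - l * d * (s - t))
  with ((G (g s) - G (g t) - l * (g s - g t)) + l * (g s - g t - d * (s - t)))
  by ring.
eapply Rle_trans; [apply Rabs_triang|]; rewrite Rabs_mult; lra.
Qed.

Lemma deriv_within_lipschitz2 h L1 L2 p y t dp dy :
  0 <= L1 -> 0 <= L2 -> lipschitz2 h L1 L2 ->
  deriv_within p t dp 0 -> deriv_within y t dy 0 ->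
  deriv_within (fun s => h (p s) (y s)) t 0 (L1 * Rabs dp + L2 * Rabs dy).
Proof.
intros HL1 HL2 [Hh1 Hh2] Hp Hy eps Heps.
set (e := eps / (L1 + L2 + 1)).
assert (He : 0 < e) by (apply Rdiv_lt_0_compat; lra).
assert (He' : e * (L1 + L2 + 1) = eps) by (unfold e; field; lra).
destruct (Hp e He) as [d1 [Hd1 H1]]; destruct (Hy e He) as [d2 [Hd2 H2]].
exists (Rmin d1 d2); split; [now apply Rmin_glb_lt|]; intros s Hs Hst.
specialize (H1 s Hs (Rlt_le_trans _ _ _ Hst (Rmin_l _ _))).
specialize (H2 s Hs (Rlt_le_trans _ _ _ Hst (Rmin_r _ _))).
assert (G : forall g d, Rabs (g s - g t - d * (s - t)) <= (0 + e) * Rabs (s - t) ->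
              Rabs (g s - g t) <= (Rabs d + e) * Rabs (s - t)).
{ intros g d H.
  replace (g s - g t) with ((g s - g t - d * (s - t)) + d * (s - t)) by ring.
  eapply Rle_trans; [apply Rabs_triang|]; rewrite Rabs_mult; lra. }
apply G in H1; apply G in H2.
replace (h (p s) (y s) - h (p t) (y t) - 0 * (s - t))
  with ((h (p s) (y s) - h (p t) (y s)) + (h (p t) (y s) - h (p t) (y t))) by ring.
eapply Rle_trans; [apply Rabs_triang|].
eapply Rle_trans; [apply Rplus_le_compat; [apply Hh1|apply Hh2]|].
apply (Rmult_le_compat_l L1) in H1; [|lra]; apply (Rmult_le_compat_l L2) in H2; [|lra].
pose proof (Rabs_pos (s - t)); nra.
Qed.

(** The integral over [[x, r]] of [h s y - h r y] in [s]: the remainder of the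
first order expansion of the potential at [r], that is, the energy stored in
the nonlinear restoring force when the reference position is [r]. *)
Definition bregman (h : R -> R -> R) (r y x : R) : R :=
  potential h r y - potential h x y - (r - x) * h r y.

Lemma bregman_bound h L1 L2 r y x : lipschitz2 h L1 L2 ->
  Rabs (bregman h r y x) <= L1 / 2 * (r - x) ^ 2.
Proof.
intros H; apply Rabs_le; unfold bregman.
pose proof (potential_remainder_upper h L1 L2 x r y 1 H (or_introl eq_refl)).
pose proof (potential_remainder_upper h L1 L2 x r y (-1) H (or_intror eq_refl)).
lra.
Qed.

(** If [r] and [y] did not move, the derivative would be the power of the
nonlinear force.  Their motion contributes an error proportional to [r - x],
not to its square or to [h] itself, because the expansion is centred at [r]:
[h (r t) (y t)] cancels in the exact part, and its variation is multiplied by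
[r - x]. *)
Lemma deriv_within_bregman h L1 L2 r y x t dr dy dx :
  0 <= t -> 0 <= L1 -> 0 <= L2 -> lipschitz2 h L1 L2 ->
  deriv_within r t dr 0 -> deriv_within y t dy 0 -> deriv_within x t dx 0 ->
  deriv_within (fun s => bregman h (r s) (y s) (x s)) t
    ((h (r t) (y t) - h (x t) (y t)) * dx)
    (Rabs (r t - x t) * (L1 * Rabs dr + 2 * L2 * Rabs dy)).
Proof.
intros Ht HL1 HL2 Hh Hr Hy Hx.
assert (He : deriv_within (fun s => r s + -1 * x s) t (dr + -1 * dx) 0).
{ eapply deriv_within_weaken;
    [apply deriv_within_plus; [exact Hr|apply deriv_within_scal, Hx]|].
  rewrite Rminus_diag, Rabs_R0; lra. }
(* With the parameter frozen at [y t] the chain rule applies; [Hrem] is the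
   price of freezing. *)
assert (Hfrozen : deriv_within
  (fun s => potential h (r s) (y t) + -1 * potential h (x s) (y t)) t
  (h (r t) (y t) * dr + -1 * (h (x t) (y t) * dx)) 0).
{ eapply deriv_within_weaken.
  - apply deriv_within_plus; [|apply deriv_within_scal].
    + apply (deriv_within_comp (fun p => potential h p (y t))); [|exact Hr].
      eapply is_derive_potential, Hh.
    + apply (deriv_within_comp (fun p => potential h p (y t))); [|exact Hx].
      eapply is_derive_potential, Hh.
  - rewrite Rminus_diag, Rabs_R0; lra. }
assert (Hpot : deriv_within
  (fun s => potential h (r s) (y s) + -1 * potential h (x s) (y s)) t
  (h (r t) (y t) * dr + -1 * (h (x t) (y t) * dx))
  (L2 * Rabs dy * Rabs (r t - x t))).
{ assert (Hrem : deriv_within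
    (fun s => (r s + -1 * x s) * (y s + - y t)) t
    ((r t - x t) * dy) 0).
  { eapply deriv_within_weaken; [apply deriv_within_mult; [exact He|]|].
    - apply deriv_within_plus; [exact Hy|].
      apply deriv_within_of_derive, @is_derive_const.
    - unfold zero; simpl.
      replace ((dr + -1 * dx) * (y t + - y t) + (r t + -1 * x t) * (dy + 0)
               - (r t - x t) * dy) with 0 by ring.
      rewrite Rabs_R0; lra. }
  intros eps Heps.
  destruct (Hfrozen (eps / 2)) as [d1 [Hd1 H1]]; [lra|].
  destruct (Hrem (eps / 2 / (L2 + 1))) as [d2 [Hd2 H2]].
  { apply Rdiv_lt_0_compat; lra. }
  exists (Rmin d1 d2); split; [now apply Rmin_glb_lt|]; intros s Hs Hst.
  specialize (H1 s Hs (Rlt_le_trans _ _ _ Hst (Rmin_l _ _))).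
  specialize (H2 s Hs (Rlt_le_trans _ _ _ Hst (Rmin_r _ _))).
  pose proof (potential_param h L1 L2 (x s) (r s) (y s) (y t) Hh) as H3.
  rewrite Rmult_assoc, (Rmult_comm (Rabs (y s - y t))), <- Rabs_mult in H3.
  set (z := Rabs (s - t)) in *; assert (Pz : 0 <= z) by apply Rabs_pos.
  assert (H4 : Rabs ((r s - x s) * (y s - y t))
    <= (Rabs (r t - x t) * Rabs dy + eps / 2 / (L2 + 1)) * z).
  { replace ((r s - x s) * (y s - y t))
      with (((r s + -1 * x s) * (y s + - y t) - (r t + -1 * x t) * (y t + - y t)
             - (r t - x t) * dy * (s - t)) + (r t - x t) * dy * (s - t)) by ring.
    eapply Rle_trans; [apply Rabs_triang|].
    rewrite (Rabs_mult ((r t - x t) * dy)), (Rabs_mult (r t - x t)); fold z; lra. }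
  apply (Rmult_le_compat_l L2) in H4; [|lra].
  assert (H5 : L2 * (eps / 2 / (L2 + 1)) <= eps / 2).
  { apply Rmult_le_reg_r with (L2 + 1); [lra|].
    replace (L2 * (eps / 2 / (L2 + 1)) * (L2 + 1)) with (L2 * (eps / 2))
      by (field; lra); nra. }
  apply (Rmult_le_compat_r z) in H5; [|lra].
  match goal with |- Rabs ?G <= _ => replace G with
    ((potential h (r s) (y s) - potential h (x s) (y s)
      - (potential h (r s) (y t) - potential h (x s) (y t)))
     + (potential h (r s) (y t) + -1 * potential h (x s) (y t)
        - (potential h (r t) (y t) + -1 * potential h (x t) (y t))
        - (h (r t) (y t) * dr + -1 * (h (x t) (y t) * dx)) * (s - t))) by ring end.
  eapply Rle_trans; [apply Rabs_triang|]; lra. }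
assert (Hprod := deriv_within_mult _ _ _ _ _ _ _ He
  (deriv_within_lipschitz2 h L1 L2 r y t dr dy HL1 HL2 Hh Hr Hy)).
assert (Hall := deriv_within_plus _ _ _ _ _ _ _ Hpot
  (deriv_within_scal (-1) _ _ _ _ Hprod)).
apply deriv_within_weaken with (d' := (h (r t) (y t) - h (x t) (y t)) * dx)
  (k' := Rabs (r t - x t) * (L1 * Rabs dr + 2 * L2 * Rabs dy)) in Hall.
- apply deriv_within_ext with (2 := Ht) (3 := Hall); intros s _; cbv beta.
  unfold bregman; ring.
- replace (Rabs (-1)) with 1 by (rewrite Rabs_left; lra).
  replace (r t + -1 * x t) with (r t - x t) by ring.
  match goal with |- Rabs ?G + _ <= _ => replace G with 0 by ring end.
  rewrite Rabs_R0; lra.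
Qed.

(** * The gain threshold *)

(** With the uncertainty replaced by its worst linear instance, the closed loop
has characteristic polynomial [s^3 + A s^2 + B s + g], where
[A = om + kad - L2], [B = kad * om + kap - L1] and [g = kap * om].  This is its
Routh-Hurwitz determinant [A * B - g]. *)
Definition routh L1 L2 kap kad om : R :=
  (om + kad - L2) * (kad * om + kap - L1) - kap * om.

(** The polynomial that defines [Omega], in the form which explains it: its
positivity says [routh > L2 * sqrt (g * A)] up to the sign of [routh], and this
is the condition under which a Lyapunov multiplier exists. *)
Definition quartic L1 L2 kap kad om : R :=
  routh L1 L2 kap kad om ^ 2 - L2 ^ 2 * (kap * om) * (om + kad - L2).

Lemma quartic_no_root L1 L2 kap kad om : 0 < kad ->
  omega_star L1 L2 kap kad < om -> quartic L1 L2 kap kad om <> 0.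
Proof.
intros Hk Hom E.
assert (HO : Omega L1 L2 kap kad om)
  by (unfold Omega; rewrite <- E; unfold quartic, routh; ring).
destruct (Omega_has_max L1 L2 kap kad Hk) as [m Hm]; [now exists om|].
assert (om <= m) by now apply Hm.
revert Hom; unfold omega_star; rewrite (omega_bar_max _ _ _ _ m Hm); intros Hom.
pose proof (Rmax_r 0 m).
pose proof (Rmax_r (L2 - kad) (Rmax 0 m)).
pose proof (Rmax_r ((L1 - kap) / kad) (Rmax (L2 - kad) (Rmax 0 m))).
pose proof (Rmax_r 0 (Rmax ((L1 - kap) / kad) (Rmax (L2 - kad) (Rmax 0 m)))).
lra.
Qed.

Lemma omega_star_nonneg L1 L2 kap kad : 0 < kad ->
  let o := omega_star L1 L2 kap kad in
  0 <= o /\ 0 <= o + kad - L2 /\ 0 <= kad * o + kap - L1.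
Proof.
intros Hk o; unfold o, omega_star.
set (b := omega_bar _ _ _ _).
set (z := (L1 - kap) / kad).
assert (Hz : kad * z = L1 - kap) by (unfold z; field; lra).
pose proof (Rmax_l (L2 - kad) b).
pose proof (Rmax_l z (Rmax (L2 - kad) b)); pose proof (Rmax_r z (Rmax (L2 - kad) b)).
pose proof (Rmax_l 0 (Rmax z (Rmax (L2 - kad) b))).
pose proof (Rmax_r 0 (Rmax z (Rmax (L2 - kad) b))).
repeat split; nra.
Qed.

(** The leading terms are [kad * y^2] and [kad^2 * y^4]. *)
Lemma routh_quartic_large L1 L2 kap kad om : 0 < L2 -> 0 < kap -> 0 < kad ->
  exists y, om < y /\ 0 < routh L1 L2 kap kad y /\ 0 < quartic L1 L2 kap kad y.
Proof.
intros HL2 Hkap Hk.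
set (p := kad * (kad - L2) - L1); set (s := (kap - L1) * (kad - L2)).
set (y := 1 + Rabs om + kad + 2 * (Rabs p + Rabs s) / kad
          + 8 * L2 ^ 2 * kap / kad ^ 2).
pose proof (Rabs_pos p); pose proof (Rabs_pos s); pose proof (Rabs_pos om).
assert (0 <= 2 * (Rabs p + Rabs s) / kad) by (apply Rdiv_le_0_compat; lra).
assert (0 <= 8 * L2 ^ 2 * kap / kad ^ 2) by (apply Rdiv_le_0_compat; nra).
assert (Hy1 : 1 <= y) by (unfold y; lra).
assert (Hy2 : 2 * (Rabs p + Rabs s) <= kad * y).
{ apply Rle_trans with (kad * (2 * (Rabs p + Rabs s) / kad)); [right; field; lra|].
  apply Rmult_le_compat_l; unfold y; lra. }
assert (Hy3 : 8 * L2 ^ 2 * kap < kad ^ 2 * y).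
{ apply Rle_lt_trans with (kad ^ 2 * (8 * L2 ^ 2 * kap / kad ^ 2));
    [right; field; lra|].
  apply Rmult_lt_compat_l; [nra|unfold y; lra]. }
assert (Hy4 : kad <= y) by (unfold y; lra).
assert (Hy5 : om < y) by (unfold y; pose proof (Rle_abs om); lra).
clearbody y.
assert (Hp : - Rabs p <= p) by (pose proof (Rle_abs (- p)); rewrite Rabs_Ropp in *; lra).
assert (Hs : - Rabs s <= s) by (pose proof (Rle_abs (- s)); rewrite Rabs_Ropp in *; lra).
assert (Hr : kad / 2 * y ^ 2 <= routh L1 L2 kap kad y).
{ replace (routh L1 L2 kap kad y) with (kad * y ^ 2 + p * y + s)
    by (unfold routh, p, s; ring).
  assert ((2 * (Rabs p + Rabs s)) * y <= kad * y * y)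
    by (apply Rmult_le_compat_r; lra).
  nra. }
assert (Hy0 : 0 < y ^ 2) by nra.
exists y; split; [exact Hy5|]; split; [nra|].
unfold quartic.
assert ((kad / 2 * y ^ 2) ^ 2 <= routh L1 L2 kap kad y ^ 2)
  by (apply pow_incr; split; [nra|exact Hr]).
assert (L2 ^ 2 * (kap * y) * (y + kad - L2) <= L2 ^ 2 * kap * (2 * y ^ 2)).
{ replace (L2 ^ 2 * (kap * y) * (y + kad - L2))
    with (L2 ^ 2 * kap * (y * (y + kad - L2))) by ring.
  apply Rmult_le_compat_l; nra. }
assert (8 * L2 ^ 2 * kap * y ^ 2 < kad ^ 2 * y * y ^ 2)
  by (apply Rmult_lt_compat_r; lra).
assert (kad ^ 2 * y ^ 2 * y <= kad ^ 2 * y ^ 2 * y ^ 2)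
  by (apply Rmult_le_compat_l; nra).
nra.
Qed.

Lemma quartic_pos L1 L2 kap kad om : 0 < L2 -> 0 < kap -> 0 < kad ->
  omega_star L1 L2 kap kad < om -> 0 < quartic L1 L2 kap kad om.
Proof.
intros HL2 Hkap Hk Hom; apply Rnot_le_lt; intros [Hneg|E].
- destruct (routh_quartic_large L1 L2 kap kad om) as [y [Hy [_ Hpos]]]; try assumption.
  destruct (IVT (quartic L1 L2 kap kad) om y) as [z [Hz Ez]]; try assumption.
  { unfold quartic, routh; reg. }
  apply (quartic_no_root L1 L2 kap kad z); [exact Hk|lra|exact Ez].
- now apply (quartic_no_root L1 L2 kap kad om).
Qed.

(** Beyond [omega_star] the quartic has no root, hence keeps the positive sign it
has at infinity.  There [routh] cannot change sign either, since at a zero of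
[routh] the quartic is negative. *)
Lemma above_omega_star L1 L2 kap kad om : 0 < L2 -> 0 < kap -> 0 < kad ->
  omega_star L1 L2 kap kad < om ->
  let A := om + kad - L2 in let B := kad * om + kap - L1 in let g := kap * om in
  0 < om /\ 0 < A /\ 0 < B /\ g < A * B /\ L2 ^ 2 * g * A < (A * B - g) ^ 2.
Proof.
intros HL2 Hkap Hk Hom A B g.
destruct (omega_star_nonneg L1 L2 kap kad Hk) as [H0 [H1 H2]].
assert (0 < om /\ 0 < A /\ 0 < B) as [Ho [HA HB]].
{ unfold A, B; repeat split; nra. }
repeat split; try assumption.
- apply Rnot_le_lt; intros Hle.
  assert (exists z, om <= z /\ routh L1 L2 kap kad z = 0) as [z [Hz Ez]].
  { destruct Hle as [Hlt|E].
    - destruct (routh_quartic_large L1 L2 kap kad om) as [y [Hy [Hpos _]]];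
        try assumption.
      destruct (IVT (routh L1 L2 kap kad) om y) as [z [Hz Ez]]; try assumption.
      { unfold routh; reg. }
      { unfold routh; fold A B g; lra. }
      now exists z.
    - exists om; split; [lra|unfold routh; fold A B g; lra]. }
  assert (Hq := quartic_pos L1 L2 kap kad z HL2 Hkap Hk ltac:(lra)).
  unfold quartic in Hq; rewrite Ez in Hq.
  assert (0 <= L2 ^ 2 * (kap * z) * (z + kad - L2)); [|lra].
  apply Rmult_le_pos; [|unfold A in HA; lra].
  apply Rmult_le_pos; nra.
- assert (Hq := quartic_pos L1 L2 kap kad om HL2 Hkap Hk Hom).
  unfold quartic, routh in Hq; fold A B g in Hq; lra.
Qed.

(** The estimate has to be uniform as the gain decreases to [omega_star], so
neither [A] nor [B] may vanish in the limit.  If [A] did, then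
[A * B > g] would fail at [omega_star + x] for small [x > 0]; if [B] did, the
quartic inequality would, [(A * B) ^ 2] being too small against [g * A]. *)
Lemma omega_star_nondegenerate L1 L2 kap kad :
  0 < L1 -> 0 < L2 -> 0 < kap -> 0 < kad ->
  let o := omega_star L1 L2 kap kad in
  0 < o + kad - L2 /\ 0 < kad * o + kap - L1.
Proof.
intros HL1 HL2 Hkap Hk o.
destruct (omega_star_nonneg L1 L2 kap kad Hk) as [H0 [H1 H2]]; fold o in H0, H1, H2.
assert (Hab : forall x, 0 < x ->
  let A := o + kad - L2 + x in let B := kad * o + kap - L1 + kad * x in
  let g := kap * (o + x) in
  0 < A /\ 0 < B /\ g < A * B /\ L2 ^ 2 * g * A < (A * B - g) ^ 2).
{ intros x Hx.
  destruct (above_omega_star L1 L2 kap kad (o + x) HL2 Hkap Hk) as [_ H];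
    [fold o; lra|].
  replace (o + x + kad - L2) with (o + kad - L2 + x) in H by ring.
  replace (kad * (o + x) + kap - L1) with (kad * o + kap - L1 + kad * x) in H by ring.
  exact H. }
cbv zeta in Hab.
split; apply Rnot_le_lt; intros Hle.
- assert (E : o + kad - L2 = 0) by lra; rewrite E in Hab.
  set (x := Rmin L1 kap / kad).
  assert (Hm : 0 < Rmin L1 kap) by now apply Rmin_glb_lt.
  assert (Hx : 0 < x) by now apply Rdiv_lt_0_compat.
  assert (Hkx : kad * x = Rmin L1 kap) by (unfold x; field; lra).
  pose proof (Rmin_l L1 kap); pose proof (Rmin_r L1 kap).
  destruct (Hab x Hx) as [_ [_ [HAB _]]]; nra.
- assert (E : kad * o + kap - L1 = 0) by lra; rewrite E in Hab.
  set (a := o + kad - L2) in *.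
  set (z := L2 ^ 2 * kap / ((a + 1) * kad ^ 2)).
  assert (Hz0 : 0 < z) by (apply Rdiv_lt_0_compat; apply Rmult_lt_0_compat; nra).
  set (x := Rmin 1 z).
  assert (Hx : 0 < x) by (apply Rmin_glb_lt; lra).
  assert (Hx1 : x <= 1) by apply Rmin_l.
  assert (Hxz : x * ((a + 1) * kad ^ 2) <= L2 ^ 2 * kap).
  { replace (L2 ^ 2 * kap) with (z * ((a + 1) * kad ^ 2))
      by (unfold z; field; split; nra).
    apply Rmult_le_compat_r; [nra|apply Rmin_r]. }
  clearbody x.
  destruct (Hab x Hx) as [HA [HB [HAB Hq]]].
  rewrite Rplus_0_l in *.
  set (A := a + x) in *; set (B := kad * x) in *; set (g := kap * (o + x)) in *.
  assert (Hg : kap * x <= g) by (unfold g; nra).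
  assert ((A * B - g) ^ 2 <= (A * B) ^ 2) by (apply pow_incr; nra).
  assert (A * (L2 ^ 2 * g) < A * (A * B ^ 2)) by nra.
  assert (C : L2 ^ 2 * g < A * B ^ 2) by now apply Rmult_lt_reg_l with A.
  assert (L2 ^ 2 * (kap * x) <= L2 ^ 2 * g) by (apply Rmult_le_compat_l; nra).
  assert (A * B ^ 2 <= (a + 1) * kad ^ 2 * x * x).
  { unfold A, B; replace ((a + x) * (kad * x) ^ 2)
      with ((a + x) * (kad ^ 2 * x * x)) by ring.
    replace ((a + 1) * kad ^ 2 * x * x) with ((a + 1) * (kad ^ 2 * x * x)) by ring.
    apply Rmult_le_compat_r; [|lra].
    apply Rmult_le_pos; nra. }
  nra.
Qed.

(** * Lyapunov multipliers with a uniform margin *)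

Lemma quadratic_form_nonneg a b c x y :
  0 < c -> b ^ 2 <= 4 * a * c -> 0 <= a * x ^ 2 + b * (x * y) + c * y ^ 2.
Proof.
intros Hc Hd; apply Rmult_le_reg_l with (4 * c); [lra|].
replace (4 * c * (a * x ^ 2 + b * (x * y) + c * y ^ 2))
  with ((2 * c * y + b * x) ^ 2 + (4 * a * c - b ^ 2) * x ^ 2) by ring.
pose proof (pow2_ge_0 (2 * c * y + b * x)); pose proof (pow2_ge_0 x); nra.
Qed.

(** Dissipation with a uniform margin.  Here [D1] and [D2] are the damping of
velocity and position at the worst slope [th = - L2], where the inequality
[L2 ^ 2 * mu ^ 2 <= 4 * D1 * D2] may be an equality.  Centring the cross term
at [th = - eps] instead of [0] gains at [th = - L2]; the loss for other slopes
is paid by the velocity damping, which increases with [th]. *)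
Lemma form_margin L2 mu0 K : 0 < L2 -> 0 < mu0 -> 1 <= K ->
  exists eps m, 0 < eps <= L2 /\ 0 < m <= 1 /\
    forall mu D1 D2, mu0 <= mu <= K -> 0 < D1 <= K -> 0 < D2 <= K ^ 2 ->
      L2 ^ 2 * mu ^ 2 <= 4 * D1 * D2 ->
      m <= D2 / K /\
      forall th v e, - L2 <= th <= L2 ->
        m * (e ^ 2 + v ^ 2)
          <= (D1 + L2 + th) * v ^ 2 + mu * (th + eps) * (v * e) + D2 * e ^ 2.
Proof.
intros HL2 Hmu0 HK.
set (m1 := L2 ^ 2 * mu0 ^ 2 / (4 * K)).
assert (Hm1 : 0 < m1) by (apply Rdiv_lt_0_compat; [apply Rmult_lt_0_compat; nra|lra]).
assert (Em1 : m1 * (4 * K) = L2 ^ 2 * mu0 ^ 2) by (unfold m1; field; lra).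
clearbody m1.
set (eps := Rmin L2 (m1 / K ^ 2)).
assert (He : 0 < eps).
{ apply Rmin_glb_lt; [exact HL2|apply Rdiv_lt_0_compat; nra]. }
assert (He1 : eps <= L2) by apply Rmin_l.
assert (He2 : eps * K ^ 2 <= m1).
{ apply Rle_trans with (m1 / K ^ 2 * K ^ 2); [|right; field; lra].
  apply Rmult_le_compat_r; [nra|apply Rmin_r]. }
clearbody eps.
set (m2 := L2 * eps * mu0 ^ 2 / (8 * K ^ 2)).
assert (Hm2 : 0 < m2).
{ apply Rdiv_lt_0_compat; [|nra]; apply Rmult_lt_0_compat; nra. }
assert (Em2 : m2 * (8 * K ^ 2) = L2 * eps * mu0 ^ 2) by (unfold m2; field; lra).
clearbody m2.
set (m := Rmin (Rmin 1 m2) (m1 / (2 * K))).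
assert (Hm3 : 0 < m1 / (2 * K)) by (apply Rdiv_lt_0_compat; lra).
assert (Hm : 0 < m) by (repeat apply Rmin_glb_lt; lra).
assert (Hma : m <= 1 /\ m <= m2).
{ pose proof (Rmin_l (Rmin 1 m2) (m1 / (2 * K))); fold m in H.
  pose proof (Rmin_l 1 m2); pose proof (Rmin_r 1 m2); lra. }
assert (Hmb : m * (2 * K) <= m1).
{ apply Rle_trans with (m1 / (2 * K) * (2 * K)); [|right; field; lra].
  apply Rmult_le_compat_r; [lra|apply Rmin_r]. }
clearbody m.
exists eps, m; split; [lra|]; split; [lra|].
intros mu D1 D2 Hmu HD1 HD2 HD.
assert (Hmu2 : mu0 ^ 2 <= mu ^ 2) by (apply pow_incr; lra).
assert (HmuK : mu ^ 2 <= K ^ 2) by (apply pow_incr; lra).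
assert (HDm : m1 <= D2).
{ apply Rmult_le_reg_r with (4 * K); [lra|]; rewrite Em1.
  apply Rle_trans with (L2 ^ 2 * mu ^ 2); [apply Rmult_le_compat_l; nra|].
  apply Rle_trans with (4 * D1 * D2); [exact HD|nra]. }
split.
{ apply Rmult_le_reg_r with K; [lra|].
  replace (D2 / K * K) with D2 by (field; lra); nra. }
intros th v e Hth.
enough (0 <= (D1 - m + (L2 + th)) * v ^ 2 + mu * (th + eps) * (v * e)
             + (D2 - m) * e ^ 2) by lra.
assert (Hm12 : m <= m1 / 2) by nra.
apply quadratic_form_nonneg; [lra|].
(* [tau] is the distance of the slope from its worst value. *)
set (tau := L2 + th); assert (Htau : 0 <= tau <= 2 * L2) by (unfold tau; lra).
replace th with (tau - L2) by (unfold tau; ring); clearbody tau.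
assert (C1 : mu ^ 2 * (L2 - eps) ^ 2 <= 4 * (D1 - m) * (D2 - m)).
{ assert (4 * m * (D1 + D2) <= 4 * m2 * (2 * K ^ 2)).
  { apply Rmult_le_compat; nra. }
  assert (L2 * eps * mu0 ^ 2 <= L2 * eps * mu ^ 2) by (apply Rmult_le_compat_l; nra).
  assert (mu ^ 2 * (L2 - eps) ^ 2 <= mu ^ 2 * (L2 ^ 2 - L2 * eps))
    by (apply Rmult_le_compat_l; nra).
  nra. }
assert (C2 : mu ^ 2 * (tau * (2 * eps)) <= 4 * tau * (D2 - m)).
{ replace (mu ^ 2 * (tau * (2 * eps))) with (tau * (2 * (eps * mu ^ 2))) by ring.
  replace (4 * tau * (D2 - m)) with (tau * (4 * (D2 - m))) by ring.
  apply Rmult_le_compat_l; [lra|].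
  assert (eps * mu ^ 2 <= eps * K ^ 2) by (apply Rmult_le_compat_l; lra).
  lra. }
assert (C3 : mu ^ 2 * (tau * (tau - 2 * L2)) <= 0).
{ assert (tau * (tau - 2 * L2) <= 0) by nra; pose proof (pow2_ge_0 mu); nra. }
replace ((mu * (tau - L2 + eps)) ^ 2)
  with (mu ^ 2 * (L2 - eps) ^ 2 + mu ^ 2 * (tau * (2 * eps))
        + mu ^ 2 * (tau * (tau - 2 * L2))) by ring.
lra.
Qed.

(** In terms of [s = 1 / mu] the requirement is
[L2 ^ 2 <= 4 * (A * s - 1) * (B - g * s)].  The right-hand side is largest at the
midpoint of [1 / A] and [B / g], where its value is [(A * B - g) ^ 2 / (A * g)]:
this is where the quartic comes from.  When [g] tends to [0] the midpoint goes
to infinity, but then a large constant [S] serves as well; so [s] stays bounded,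
that is,
the multiplier [mu] stays away from [0]. *)
Lemma multiplier_exists L2 A0 B0 : 0 < L2 -> 0 < A0 -> 0 < B0 ->
  exists S, 0 < S /\ forall A B g, A0 <= A -> B0 <= B -> 0 < g -> g < A * B ->
    L2 ^ 2 * g * A <= (A * B - g) ^ 2 ->
    exists s, 0 < s <= S /\ 1 < A * s /\ g * s < B /\
      L2 ^ 2 <= 4 * (A * s - 1) * (B - g * s).
Proof.
intros HL2 HA0 HB0.
set (S := (2 + 2 * L2 ^ 2 / B0) / A0).
assert (Hq : 0 <= 2 * L2 ^ 2 / B0) by (apply Rdiv_le_0_compat; nra).
assert (HS : 0 < S) by (apply Rdiv_lt_0_compat; lra).
assert (ES : A0 * S = 2 + 2 * L2 ^ 2 / B0) by (unfold S; field; lra).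
assert (EB : B0 * (2 * L2 ^ 2 / B0) = 2 * L2 ^ 2) by (field; lra).
set (x := 2 * L2 ^ 2 / B0) in *; clearbody S x.
exists S; split; [exact HS|]; intros A B g HA HB Hg HAB HD.
(* The midpoint of [1 / A] and [B / g]. *)
set (s := (A * B + g) / (2 * A * g)).
assert (Hs : 0 < s) by (apply Rdiv_lt_0_compat; nra).
assert (E1 : 2 * g * (A * s - 1) = A * B - g) by (unfold s; field; lra).
assert (E2 : 2 * A * (B - g * s) = A * B - g) by (unfold s; field; lra).
destruct (Rle_dec s S) as [HsS|HsS].
- exists s; clearbody s; repeat split; try nra.
  apply Rmult_le_reg_r with (g * A); [nra|].
  replace (4 * (A * s - 1) * (B - g * s) * (g * A))
    with ((2 * g * (A * s - 1)) * (2 * A * (B - g * s))) by ring.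
  rewrite E1, E2; lra.
- exists S; apply Rnot_le_lt in HsS; clearbody s.
  assert (HAS : 2 + x <= A * S) by nra.
  assert (H3 : 3 * g <= A * B).
  { assert (2 * g * (A * S - 1) < 2 * g * (A * s - 1))
      by (apply Rmult_lt_compat_l; nra). nra. }
  assert (HgS : B / 3 <= B - g * S).
  { assert (2 * A * (B - g * s) <= 2 * A * (B - g * S))
      by (apply Rmult_le_compat_l; nra).
    apply Rmult_le_reg_l with (2 * A); [lra|]; nra. }
  assert ((1 + x) * (B0 / 3) <= (A * S - 1) * (B - g * S))
    by (apply Rmult_le_compat; nra).
  repeat split; nra.
Qed.

(** All multipliers needed by the Lyapunov function, with a margin [m] common to
all gains between [omega_star] and a given bound.  The slopes [th] and [be]
stand for the difference quotients of the uncertainty in velocity and position;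
[be] includes the linear position gain, and only its lower bound matters. *)
Lemma lyapunov_margin L1 L2 kap kad K :
  0 < L1 -> 0 < L2 -> 0 < kap -> 0 < kad -> 1 <= K ->
  exists m, 0 < m <= 1 /\
    forall om, omega_star L1 L2 kap kad < om ->
      om + kad <= K -> kad * om + kap <= K ->
    exists mu c, m <= mu <= K /\ 0 <= c <= K ^ 2 /\
      m <= c + (kad * om + kap - L1) - mu ^ 2 - kap * om / mu /\
      forall th be v e, - L2 <= th <= L2 -> kad * om + kap - L1 <= be ->
        m * (e ^ 2 + v ^ 2)
          <= (om + kad + th - mu) * v ^ 2 + (mu * (om + kad + th) - c) * (v * e)
             + (mu * be - kap * om) * e ^ 2.
Proof.
intros HL1 HL2 Hkap Hk HK.
destruct (omega_star_nondegenerate L1 L2 kap kad HL1 HL2 Hkap Hk) as [HA0 HB0].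
set (o := omega_star L1 L2 kap kad) in *.
destruct (multiplier_exists L2 _ _ HL2 HA0 HB0) as [S [HS Hmult]].
assert (HSi : 0 < / S) by now apply Rinv_0_lt_compat.
destruct (form_margin L2 (/ S) K HL2 HSi HK) as [eps [m [He [Hm Hform]]]].
exists (Rmin m (/ S)); split.
{ pose proof (Rmin_l m (/ S)); split; [apply Rmin_glb_lt|]; lra. }
intros om Hom HK1 HK2.
destruct (above_omega_star L1 L2 kap kad om HL2 Hkap Hk Hom)
  as [Ho [HA [HB [HAB HD]]]].
set (A := om + kad - L2) in *; set (B := kad * om + kap - L1) in *.
set (g := kap * om) in *; assert (Hg : 0 < g) by (unfold g; nra).
destruct (Hmult A B g) as [s [Hs [H1 [H2 H3]]]]; try lra.
{ unfold A, o in *; lra. }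
{ unfold B, o in *; nra. }
set (mu := / s).
assert (Hmu : 0 < mu) by (apply Rinv_0_lt_compat; lra).
assert (Hsmu : s * mu = 1) by (unfold mu; field; lra).
assert (HmuS : / S <= mu) by (apply Rinv_le_contravar; lra).
assert (EA : A - mu = mu * (A * s - 1)) by (unfold mu; field; lra).
assert (EB : mu * B - g = mu * (B - g * s)) by (unfold mu; field; lra).
assert (Eg : g / mu = g * s) by (unfold mu; field; lra).
assert (HD1 : 0 < A - mu) by (rewrite EA; nra).
assert (HD2 : 0 < mu * B - g) by (rewrite EB; nra).
assert (HAK : A <= K) by (unfold A; lra).
assert (HBK : B <= K) by (unfold B; lra).
clearbody mu.
destruct (Hform mu (A - mu) (mu * B - g)) as [Hm1 Hm2].
{ lra. }
{ lra. }
{ split; [exact HD2|].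
  assert (mu * B <= K * K) by (apply Rmult_le_compat; lra); nra. }
{ rewrite EA, EB.
  replace (4 * (mu * (A * s - 1)) * (mu * (B - g * s)))
    with (4 * (A * s - 1) * (B - g * s) * mu ^ 2) by ring.
  apply Rmult_le_compat_r; [nra|exact H3]. }
exists mu, (mu * (om + kad - eps)).
pose proof (Rmin_l m (/ S)); pose proof (Rmin_r m (/ S)).
assert (EL : om + kad = A + L2) by (unfold A; ring).
repeat split.
- lra.
- lra.
- rewrite EL; nra.
- replace (K ^ 2) with (K * K) by ring; apply Rmult_le_compat; lra.
- rewrite EL, Eg.
  assert ((mu * B - g) / K <= B - g * s).
  { apply Rmult_le_reg_r with K; [lra|].
    replace ((mu * B - g) / K * K) with (mu * B - g) by (field; lra).
    rewrite EB; nra. }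
  replace (mu * (A + L2 - eps) + B - mu ^ 2 - g * s)
    with (mu * (A - mu) + mu * (L2 - eps) + (B - g * s)) by ring.
  nra.
- intros th be v e Hth Hbe.
  specialize (Hm2 th v e Hth).
  assert (Rmin m (/ S) * (e ^ 2 + v ^ 2) <= m * (e ^ 2 + v ^ 2))
    by (apply Rmult_le_compat_r; [nra|lra]).
  assert (mu * B * e ^ 2 <= mu * be * e ^ 2).
  { apply Rmult_le_compat_r; [nra|]; apply Rmult_le_compat_l; lra. }
  rewrite EL.
  replace (mu * (A + L2 + th) - mu * (A + L2 - eps)) with (mu * (th + eps)) by ring.
  lra.
Qed.

(** * Estimates for the Lyapunov function *)

Lemma Rabs_mult_le a b A B : Rabs a <= A -> Rabs b <= B -> Rabs (a * b) <= A * B.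
Proof.
intros Ha Hb; rewrite Rabs_mult; apply Rmult_le_compat; auto using Rabs_pos.
Qed.

(** Twice the right-hand side, without the cross term [kappa * (W * v)], is at least
[p^2 + (mu / g) * z^2 + m * e^2] with [p] and [z] the completed squares below;
[kappa] is so small that the cross term costs only a fraction of this. *)
Lemma lyapunov_coercive m K kappa mu c g kp L1 e v W Psi :
  0 < m <= 1 -> 1 <= K -> kappa * (20 * K ^ 2) = m ^ 3 ->
  m <= mu <= K -> 0 < g <= K ->
  m <= c + (kp - L1) - mu ^ 2 - g / mu -> Rabs Psi <= L1 / 2 * e ^ 2 ->
  kappa * (e ^ 2 + v ^ 2 + W ^ 2)
    <= / 2 * v ^ 2 + mu * (e * v) + (c + kp) / 2 * e ^ 2 + Psi + W * e
       + mu / (2 * g) * W ^ 2 + kappa * (W * v).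
Proof.
intros Hm HK Hk Hmu Hg Hc HPsi.
set (a := mu / g); set (b := g / mu) in *.
assert (Hab : a * b = 1) by (unfold a, b; field; lra).
replace (mu / (2 * g)) with (a / 2) by (unfold a; field; lra).
assert (Ha : m <= a * K).
{ unfold a; apply Rmult_le_reg_r with g; [lra|].
  replace (mu / g * K * g) with (mu * K) by (field; lra); nra. }
assert (Hb : b * m <= K).
{ unfold b; apply Rmult_le_reg_r with mu; [lra|].
  replace (g / mu * m * mu) with (g * m) by (field; lra); nra. }
assert (Hb0 : 0 < b) by (apply Rdiv_lt_0_compat; lra).
assert (Ha0 : 0 < a) by (apply Rdiv_lt_0_compat; lra).
clearbody a b.
pose proof (Rle_abs (- Psi)) as HP; rewrite Rabs_Ropp in HP.
assert (Hk0 : 0 < kappa).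
{ apply Rmult_lt_reg_r with (20 * K ^ 2); [nra|]; rewrite Hk, Rmult_0_l.
  apply pow_lt; lra. }
assert (Hm2 : 0 < m ^ 2 <= 1) by (split; [apply pow_lt; lra|nra]).
assert (Hm3 : m ^ 3 <= m) by (replace (m ^ 3) with (m * m ^ 2) by ring; nra).
assert (HK2 : 1 <= K ^ 2) by nra.
set (p := v + mu * e); set (z := W + b * e).
assert (HN : e ^ 2 + v ^ 2 + W ^ 2
             <= 2 * p ^ 2 + 2 * z ^ 2 + (1 + 2 * mu ^ 2 + 2 * b ^ 2) * e ^ 2).
{ replace v with (p - mu * e) by (unfold p; ring).
  replace W with (z - b * e) by (unfold z; ring).
  pose proof (pow2_ge_0 (p + mu * e)); pose proof (pow2_ge_0 (z + b * e)); nra. }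
assert (HU : p ^ 2 + a * z ^ 2 + m * e ^ 2
  <= v ^ 2 + 2 * mu * (e * v) + (c + kp) * e ^ 2 + 2 * Psi + 2 * (W * e) + a * W ^ 2).
{ replace (p ^ 2 + a * z ^ 2 + m * e ^ 2)
    with (v ^ 2 + 2 * mu * (e * v) + 2 * (a * b) * (W * e) + a * W ^ 2
          + (mu ^ 2 + (a * b) * b + m) * e ^ 2) by (unfold p, z; ring).
  rewrite Hab.
  assert ((mu ^ 2 + 1 * b + m) * e ^ 2 <= (c + (kp - L1)) * e ^ 2).
  { apply Rmult_le_compat_r; [apply pow2_ge_0|lra]. }
  lra. }
assert (K1 : 6 * kappa <= 1).
{ apply Rmult_le_reg_r with (20 * K ^ 2); [nra|].
  replace (6 * kappa * (20 * K ^ 2)) with (6 * m ^ 3) by (rewrite <- Hk; ring).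
  lra. }
assert (K2 : 6 * kappa <= a).
{ apply Rmult_le_reg_r with (20 * K ^ 2); [nra|].
  replace (6 * kappa * (20 * K ^ 2)) with (6 * m ^ 3) by (rewrite <- Hk; ring).
  replace (a * (20 * K ^ 2)) with (20 * (a * K * K)) by ring.
  assert (m <= a * K * K) by nra; lra. }
assert (K3 : 3 * kappa * (1 + 2 * mu ^ 2 + 2 * b ^ 2) <= m).
{ apply Rmult_le_reg_r with (20 * K ^ 2 * m ^ 2); [nra|].
  replace (3 * kappa * (1 + 2 * mu ^ 2 + 2 * b ^ 2) * (20 * K ^ 2 * m ^ 2))
    with (3 * m ^ 3 * (m ^ 2 + 2 * (mu ^ 2 * m ^ 2) + 2 * (b * m) ^ 2))
    by (rewrite <- Hk; ring).
  assert (mu ^ 2 * m ^ 2 <= K ^ 2 * 1).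
  { apply Rmult_le_compat; [nra|lra|apply pow_incr; lra|lra]. }
  assert ((b * m) ^ 2 <= K ^ 2) by (apply pow_incr; nra).
  replace (m * (20 * K ^ 2 * m ^ 2)) with (3 * m ^ 3 * (20 / 3 * K ^ 2)) by field.
  assert (0 < m ^ 3) by (apply pow_lt; lra).
  apply Rmult_le_compat_l; lra. }
assert (HWv : - (W ^ 2 + v ^ 2) <= 2 * (W * v))
  by (pose proof (pow2_ge_0 (W + v)); lra).
assert (2 * kappa * p ^ 2 * 3 <= p ^ 2) by (pose proof (pow2_ge_0 p); nra).
assert (2 * kappa * z ^ 2 * 3 <= a * z ^ 2) by (pose proof (pow2_ge_0 z); nra).
assert (3 * kappa * (1 + 2 * mu ^ 2 + 2 * b ^ 2) * e ^ 2 <= m * e ^ 2)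
  by (apply Rmult_le_compat_r; [apply pow2_ge_0|lra]).
assert (3 * kappa * (e ^ 2 + v ^ 2 + W ^ 2)
  <= p ^ 2 + a * z ^ 2 + m * e ^ 2).
{ apply (Rmult_le_compat_l (3 * kappa)) in HN; [|lra]; nra. }
assert (- kappa * (e ^ 2 + v ^ 2 + W ^ 2) <= kappa * (2 * (W * v))).
{ pose proof (pow2_ge_0 e); nra. }
lra.
Qed.

(** The factor [g] compensates the coefficient [mu / (2 * g)] of [W ^ 2], the only
one that is unbounded for small gains. *)
Lemma lyapunov_upper K kappa mu c g kp L1 e v W Psi :
  1 <= K -> 0 <= kappa <= 1 -> 0 < mu <= K -> 0 < g <= K ->
  0 <= c <= K ^ 2 -> 0 <= kp <= K -> 0 <= L1 <= K -> Rabs Psi <= L1 / 2 * e ^ 2 ->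
  g * (/ 2 * v ^ 2 + mu * (e * v) + (c + kp) / 2 * e ^ 2 + Psi + W * e
       + mu / (2 * g) * W ^ 2 + kappa * (W * v))
    <= 5 * K ^ 3 * (e ^ 2 + v ^ 2 + W ^ 2).
Proof.
intros HK Hka Hmu Hg Hc Hkp HL1 HPsi.
pose proof (Rle_abs Psi) as HP.
replace (g * _) with
  (g * (/ 2 * v ^ 2 + mu * (e * v) + (c + kp) / 2 * e ^ 2 + Psi + W * e
       + kappa * (W * v)) + mu / 2 * W ^ 2) by (field; lra).
pose proof (pow2_ge_0 e); pose proof (pow2_ge_0 v); pose proof (pow2_ge_0 W).
assert (HK2 : K <= K ^ 2) by nra.
assert (HK3 : K ^ 2 <= K ^ 3) by nra.
assert (A1 : mu * (e * v) <= K * ((e ^ 2 + v ^ 2) / 2)).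
{ assert (e * v <= (e ^ 2 + v ^ 2) / 2) by (pose proof (pow2_ge_0 (e - v)); nra).
  apply Rle_trans with (mu * ((e ^ 2 + v ^ 2) / 2));
    [apply Rmult_le_compat_l; lra|apply Rmult_le_compat_r; lra]. }
assert (A2 : W * e <= (W ^ 2 + e ^ 2) / 2) by (pose proof (pow2_ge_0 (e - W)); nra).
assert (A3 : kappa * (W * v) <= (W ^ 2 + v ^ 2) / 2).
{ assert (W * v <= (W ^ 2 + v ^ 2) / 2) by (pose proof (pow2_ge_0 (v - W)); nra).
  nra. }
assert (A4 : (c + kp) / 2 * e ^ 2 <= K ^ 2 * e ^ 2)
  by (apply Rmult_le_compat_r; lra).
assert (A5 : Psi <= K / 2 * e ^ 2).
{ apply Rle_trans with (L1 / 2 * e ^ 2); [lra|apply Rmult_le_compat_r; lra]. }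
set (X := / 2 * v ^ 2 + _ + _ + _ + _ + _).
set (N := e ^ 2 + v ^ 2 + W ^ 2) in *; assert (HN : 0 <= N) by (unfold N; lra).
assert (HX : X <= 4 * K ^ 2 * N).
{ assert (K * ((e ^ 2 + v ^ 2) / 2) <= K ^ 2 * ((e ^ 2 + v ^ 2) / 2))
    by (apply Rmult_le_compat_r; lra).
  assert (K / 2 * e ^ 2 <= K ^ 2 / 2 * e ^ 2) by (apply Rmult_le_compat_r; lra).
  assert (1 * N <= K ^ 2 * N) by (apply Rmult_le_compat_r; nra).
  assert (K ^ 2 * (e ^ 2 + v ^ 2) <= K ^ 2 * N)
    by (apply Rmult_le_compat_l; [nra|unfold N; lra]).
  assert (K ^ 2 * e ^ 2 <= K ^ 2 * N)
    by (apply Rmult_le_compat_l; [nra|unfold N; lra]).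
  unfold X; unfold N in *; lra. }
assert (HgX : g * X <= K * (4 * K ^ 2 * N)).
{ apply Rle_trans with (g * (4 * K ^ 2 * N)); [apply Rmult_le_compat_l; lra|].
  apply Rmult_le_compat_r; [|lra]; apply Rmult_le_pos; nra. }
assert (mu / 2 * W ^ 2 <= K ^ 3 * N).
{ apply Rmult_le_compat; unfold N; lra. }
nra.
Qed.

(** The basic Lyapunov function dissipates only [e] and [v], by the amount [Q].
The derivative of the cross term [kappa * (W * v)] supplies the missing
[- kappa * W ^ 2]; its other terms are absorbed by [Q] thanks to the size of
[kappa].  [F] and [p] enter at most linearly in the state and cost
only the constant. *)
Lemma lyapunov_decrease m K kappa mu g kd kp e v W F phi chi p Q :
  0 < m <= 1 -> 1 <= K -> kappa * (20 * K ^ 2) = m ^ 3 ->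
  0 < mu <= K -> 0 <= g <= K -> 0 <= kd <= K -> 0 <= kp <= K ->
  Rabs F <= K -> Rabs phi <= K * Rabs e -> Rabs chi <= K * Rabs v ->
  p <= K * Rabs e -> m * (e ^ 2 + v ^ 2) <= Q ->
  - Q - F * (v + mu * e) + p
    + kappa * (g * (e * v) + W * (- kd * v - kp * e - W - F - phi - chi))
  <= - (kappa / 2) * (e ^ 2 + v ^ 2 + W ^ 2) + 9 * (K ^ 4 / m).
Proof.
intros Hm HK Hk Hmu Hg Hkd Hkp HF Hphi Hchi Hp HQ.
assert (Pe := Rabs_pos e); assert (Pv := Rabs_pos v); assert (PW := Rabs_pos W).
assert (Hm3 : 0 < m ^ 3 <= m).
{ split; [apply pow_lt; lra|]. assert (m ^ 2 <= 1) by nra.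
  replace (m ^ 3) with (m * m ^ 2) by ring; nra. }
assert (HK2 : 1 <= K ^ 2) by nra.
assert (Hk0 : 0 < kappa).
{ apply Rmult_lt_reg_r with (20 * K ^ 2); lra. }
assert (HkK : kappa * K ^ 2 <= m / 20) by lra.
assert (Hk1 : kappa <= m / 20) by nra.
set (T := K ^ 4 / m); assert (HT : T * m = K ^ 4) by (unfold T; field; lra).
assert (HT1 : K ^ 4 <= T).
{ rewrite <- HT; assert (0 <= T); [|nra].
  apply Rdiv_le_0_compat; [apply pow_le|]; lra. }
assert (HK4 : K ^ 2 <= K ^ 4) by nra.
clearbody T.
assert (Young : forall x, 0 <= x -> 2 * K ^ 2 * x <= m / 4 * x ^ 2 + 4 * T).
{ intros x Hx; apply Rmult_le_reg_r with m; [lra|].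
  replace ((m / 4 * x ^ 2 + 4 * T) * m) with (m ^ 2 / 4 * x ^ 2 + 4 * K ^ 4)
    by (rewrite <- HT; field).
  pose proof (pow2_ge_0 (m / 2 * x - 2 * K ^ 2)); nra. }
pose proof (Young _ Pe) as Ye; pose proof (Young _ Pv) as Yv; clear Young.
assert (S1 : - F * (v + mu * e) + p <= 2 * K ^ 2 * Rabs e + 2 * K ^ 2 * Rabs v).
{ assert (Hv : Rabs (F * v) <= K * Rabs v) by (apply Rabs_mult_le; lra).
  assert (He : Rabs (F * (mu * e)) <= K * (K * Rabs e)).
  { apply Rabs_mult_le; [exact HF|]; apply Rabs_mult_le; [|lra].
    rewrite Rabs_right; lra. }
  pose proof (Rle_abs (- (F * v))); pose proof (Rle_abs (- (F * (mu * e)))).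
  rewrite Rabs_Ropp in *.
  assert (K * Rabs v <= 2 * K ^ 2 * Rabs v) by (apply Rmult_le_compat_r; nra).
  assert (K * Rabs e <= K ^ 2 * Rabs e) by (apply Rmult_le_compat_r; nra).
  lra. }
assert (S2 : g * (e * v) <= K ^ 2 / 2 * (e ^ 2 + v ^ 2)).
{ assert (e * v <= (e ^ 2 + v ^ 2) / 2) by (pose proof (pow2_ge_0 (e - v)); nra).
  apply Rle_trans with (g * ((e ^ 2 + v ^ 2) / 2)); [apply Rmult_le_compat_l; lra|].
  replace (K ^ 2 / 2 * (e ^ 2 + v ^ 2)) with (K ^ 2 * ((e ^ 2 + v ^ 2) / 2)) by field.
  apply Rmult_le_compat_r; nra. }
assert (S3 : W * (- kd * v - kp * e - W - F - phi - chi)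
  <= - W ^ 2 + Rabs W * (K * (2 * Rabs v + 2 * Rabs e + 1))).
{ assert (HR : Rabs (- kd * v - kp * e - F - phi - chi)
               <= K * (2 * Rabs v + 2 * Rabs e + 1)).
  { assert (Rabs (kd * v) <= K * Rabs v)
      by (apply Rabs_mult_le; [rewrite Rabs_right|]; lra).
    assert (Rabs (kp * e) <= K * Rabs e)
      by (apply Rabs_mult_le; [rewrite Rabs_right|]; lra).
    replace (- kd * v - kp * e - F - phi - chi)
      with (- (kd * v + (kp * e + (F + (phi + chi))))) by ring.
    rewrite Rabs_Ropp.
    eapply Rle_trans; [apply Rabs_triang|].
    eapply Rle_trans; [apply Rplus_le_compat_l, Rabs_triang|].
    eapply Rle_trans; [apply Rplus_le_compat_l, Rplus_le_compat_l, Rabs_triang|].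
    eapply Rle_trans;
      [apply Rplus_le_compat_l, Rplus_le_compat_l, Rplus_le_compat_l, Rabs_triang|].
    lra. }
  replace (W * (- kd * v - kp * e - W - F - phi - chi))
    with (- W ^ 2 + W * (- kd * v - kp * e - F - phi - chi)) by ring.
  apply Rplus_le_compat_l; eapply Rle_trans; [apply Rle_abs|].
  apply Rabs_mult_le; [lra|exact HR]. }
assert (S4 : Rabs W * (K * (2 * Rabs v + 2 * Rabs e + 1))
  <= W ^ 2 / 2 + 8 * K ^ 2 * (e ^ 2 + v ^ 2) + K ^ 2).
{ rewrite <- (pow2_abs W), <- (pow2_abs e), <- (pow2_abs v).
  pose proof (pow2_ge_0 (Rabs W - 8 * K * Rabs v)).
  pose proof (pow2_ge_0 (Rabs W - 8 * K * Rabs e)).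
  pose proof (pow2_ge_0 (Rabs W / 2 - K)).
  lra. }
rewrite (pow2_abs e) in Ye; rewrite (pow2_abs v) in Yv.
assert (S5 : kappa * (g * (e * v) + W * (- kd * v - kp * e - W - F - phi - chi))
  <= kappa * (17 / 2 * K ^ 2 * (e ^ 2 + v ^ 2) - W ^ 2 / 2 + K ^ 2)).
{ apply Rmult_le_compat_l; lra. }
pose proof (pow2_ge_0 e); pose proof (pow2_ge_0 v).
assert (S6 : kappa * K ^ 2 * (e ^ 2 + v ^ 2) <= m / 20 * (e ^ 2 + v ^ 2))
  by (apply Rmult_le_compat_r; lra).
assert (S7 : kappa * (e ^ 2 + v ^ 2) <= m / 20 * (e ^ 2 + v ^ 2))
  by (apply Rmult_le_compat_r; lra).
assert (0 <= m * (e ^ 2 + v ^ 2)) by (apply Rmult_le_pos; lra).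
lra.
Qed.

(** * Gains in a bounded range *)

Lemma factor_of_le a b L : 0 <= L -> Rabs a <= L * Rabs b ->
  exists th, - L <= th <= L /\ a = th * b.
Proof.
intros HL H; destruct (Req_dec b 0) as [->|Hb].
- rewrite Rabs_R0, Rmult_0_r in H; exists 0; split; [lra|].
  destruct (Req_dec a 0) as [->|Ha]; [ring|].
  pose proof (Rabs_pos_lt a Ha); lra.
- exists (a / b); split; [|field; exact Hb].
  apply Rabs_le_between; unfold Rdiv; rewrite Rabs_mult, Rabs_inv.
  pose proof (Rabs_pos_lt b Hb).
  apply Rmult_le_reg_r with (Rabs b); [lra|].
  rewrite Rmult_assoc, Rinv_l; lra.
Qed.

(** The loop is a PID loop: [e] is the tracking error, [W] is [kap * om] times its
integral, and [dv + kad * v + kap * e] is the estimation error.  The forcing [F]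
collects the uncertainty along the reference.  The Lyapunov function [U] stays
below a constant over [g = kap * om], hence [e], [v], [W] are of size
[1 / sqrt om] when [om] is small, which is within [C / om] on a bounded range of
gains. *)
Lemma moderate_gain_bound L1 L2 kap kad K :
  0 < L1 -> 0 < L2 -> 0 < kap -> 0 < kad -> 1 <= K -> L1 <= K -> L2 <= K ->
  exists C, 0 < C /\
    forall om h r dr ddr e v dv W F,
      omega_star L1 L2 kap kad < om ->
      om + kad <= K -> kad * om + kap <= K -> kap * om <= K ->
      lipschitz2 h L1 L2 ->
      deriv_nonneg r dr -> deriv_nonneg dr ddr ->
      (forall t, 0 <= t -> 2 * L1 * Rabs (dr t) + 2 * L2 * Rabs (ddr t) <= K) ->
      (forall t, 0 <= t -> Rabs (F t) <= K) ->
      deriv_nonneg e v -> deriv_nonneg v dv ->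
      deriv_nonneg W (fun t => kap * om * e t) ->
      (forall t, 0 <= t -> dv t = - (om + kad) * v t - (kad * om + kap) * e t - W t - F t
         - (h (r t - e t) (dr t - v t) - h (r t) (dr t))) ->
      e 0 = 0 -> v 0 = 0 -> W 0 = 0 ->
      forall t, 0 <= t -> Rabs (dv t + kad * v t + kap * e t) <= C / om.
Proof.
intros HL1 HL2 Hkap Hk HK HL1K HL2K.
destruct (lyapunov_margin L1 L2 kap kad K HL1 HL2 Hkap Hk HK) as [m [Hm Hmargin]].
set (kappa := m ^ 3 / (20 * K ^ 2)).
assert (HK2 : 1 <= K ^ 2) by nra.
assert (HK3 : 1 <= K ^ 3) by nra.
assert (Ek : kappa * (20 * K ^ 2) = m ^ 3) by (unfold kappa; field; lra).
assert (Hka : 0 < kappa <= 1).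
{ assert (0 < m ^ 3) by (apply pow_lt; lra).
  assert (m ^ 3 <= 1) by (rewrite <- (pow1 3); apply pow_incr; lra).
  split; [apply Rdiv_lt_0_compat; lra|].
  apply Rmult_le_reg_r with (20 * K ^ 2); lra. }
clearbody kappa.
set (T := 9 * (K ^ 4 / m)).
assert (HT : 0 <= T).
{ unfold T; apply Rmult_le_pos; [lra|]; apply Rdiv_le_0_compat; [apply pow_le|]; lra. }
set (X := 10 * K ^ 3 * (T + 1) / kappa).
assert (EX : X * kappa = 10 * K ^ 3 * (T + 1)) by (unfold X; field; lra).
assert (HX : 0 < X).
{ apply Rdiv_lt_0_compat; [|lra]; apply Rmult_lt_0_compat; lra. }
clearbody X.
(* [X / g] bounds [U], and [Y] then bounds [om^2] times the squared norm of the state. *)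
set (Y := K * X / (kappa * kap)).
assert (HY : 0 <= Y).
{ apply Rdiv_le_0_compat; [nra|apply Rmult_lt_0_compat; lra]. }
exists (K * (5 * (1 + Y) + K)); split; [nra|].
intros om h r dr ddr e v dv W F Hom HoK HkpK HgK Hh Hr Hdr HdK HF He Hv HW Edv
  He0 Hv0 HW0.
destruct (Hmargin om Hom HoK HkpK) as [mu [c [Hmu [Hc [Hpos Hform]]]]].
destruct (above_omega_star L1 L2 kap kad om HL2 Hkap Hk Hom) as [Ho _].
set (g := kap * om) in *; assert (Hg : 0 < g) by (unfold g; nra).
set (kp := kad * om + kap) in *; set (kd := om + kad) in *.
assert (Hkp : 0 <= kp <= K) by (unfold kp in *; nra).
assert (Hkd : 0 <= kd <= K) by (unfold kd in *; lra).
(* [mu] is the multiplier of [e * v], [bregman] the nonlinear potential energy;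
   [W * v] makes the dissipation strict in [W]. *)
set (U := fun s => / 2 * v s ^ 2 + mu * (e s * v s) + (c + kp) / 2 * e s ^ 2
  + bregman h (r s) (dr s) (r s - e s) + W s * e s
  + mu / (2 * g) * W s ^ 2 + kappa * (W s * v s)).
set (N := fun s => e s ^ 2 + v s ^ 2 + W s ^ 2).
assert (Hbreg : forall s, Rabs (bregman h (r s) (dr s) (r s - e s))
                            <= L1 / 2 * e s ^ 2).
{ intros s; eapply Rle_trans; [eapply bregman_bound, Hh|].
  right; f_equal; f_equal; ring. }
assert (Hlow : forall s, kappa * N s <= U s).
{ intros s; unfold U, N; apply (lyapunov_coercive m K kappa mu c g kp L1);
    try assumption; try lra; apply Hbreg. }
assert (Hupp : forall s, g * U s <= 5 * K ^ 3 * N s).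
{ intros s; unfold U, N; apply (lyapunov_upper K kappa mu c g kp L1);
    try assumption; try lra; apply Hbreg. }
assert (HU : forall t, 0 <= t -> U t <= X / g).
{ apply barrier.
  { unfold U; rewrite He0, Hv0, HW0.
    assert (Hb0 := Hbreg 0); rewrite He0 in Hb0.
    assert (A := Rle_abs (bregman h (r 0) (dr 0) (r 0 - 0))).
    assert (0 < X / g) by (apply Rdiv_lt_0_compat; lra).
    lra. }
  intros t Ht.
  assert (De := deriv_within_of_deriv _ _ _ He Ht).
  assert (Dv := deriv_within_of_deriv _ _ _ Hv Ht).
  assert (DW := deriv_within_of_deriv _ _ _ HW Ht).
  assert (Dr := deriv_within_of_deriv _ _ _ Hr Ht).
  assert (Ddr := deriv_within_of_deriv _ _ _ Hdr Ht).
  assert (Dx : deriv_within (fun s => r s + -1 * e s) t (dr t - v t) 0).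
  { eapply deriv_within_weaken;
      [apply deriv_within_plus; [exact Dr|apply deriv_within_scal, De]|].
    replace (dr t + -1 * v t - (dr t - v t)) with 0 by ring.
    rewrite Rabs_R0; lra. }
  assert (Db := deriv_within_bregman h L1 L2 r dr _ t _ _ _ Ht
                  (Rlt_le _ _ HL1) (Rlt_le _ _ HL2) Hh Dr Ddr Dx).
  cbv beta in Db.
  set (phi := h (r t - e t) (dr t) - h (r t) (dr t)).
  set (chi := h (r t - e t) (dr t - v t) - h (r t - e t) (dr t)).
  assert (Hphi : Rabs phi <= L1 * Rabs (e t)).
  { eapply Rle_trans; [apply Hh|].
    replace (r t - e t - r t) with (- e t) by ring; rewrite Rabs_Ropp; lra. }
  assert (Hchi : Rabs chi <= L2 * Rabs (v t)).
  { eapply Rle_trans; [apply Hh|].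
    replace (dr t - v t - dr t) with (- v t) by ring; rewrite Rabs_Ropp; lra. }
  set (Q := kd * v t ^ 2 + v t * chi - mu * v t ^ 2 + (mu * kd - c) * (v t * e t)
            + mu * (e t * chi) + mu * kp * e t ^ 2 + mu * (e t * phi) - g * e t ^ 2).
  set (k := Rabs (e t) * (L1 * Rabs (dr t) + 2 * L2 * Rabs (ddr t))).
  exists (- Q - F t * (v t + mu * e t) + - phi * dr t
    + kappa * (g * (e t * v t)
               + W t * (- kd * v t - kp * e t - W t - F t - phi - chi))), k.
  split.
  - assert (D : deriv_within (fun s => / 2 * (v s * v s) + (mu * (e s * v s)
      + ((c + kp) / 2 * (e s * e s) + (bregman h (r s) (dr s) (r s + -1 * e s)
      + (W s * e s + (mu / (2 * g) * (W s * W s) + kappa * (W s * v s))))))) t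
      (- Q - F t * (v t + mu * e t) + - phi * dr t
        + kappa * (g * (e t * v t)
               + W t * (- kd * v t - kp * e t - W t - F t - phi - chi))) k).
    { eapply deriv_within_weaken.
      - apply deriv_within_plus; [apply deriv_within_scal, deriv_within_mult; exact Dv|].
        apply deriv_within_plus;
          [apply deriv_within_scal, deriv_within_mult; [exact De|exact Dv]|].
        apply deriv_within_plus; [apply deriv_within_scal, deriv_within_mult; exact De|].
        apply deriv_within_plus; [exact Db|].
        apply deriv_within_plus; [apply deriv_within_mult; [exact DW|exact De]|].
        apply deriv_within_plus; [apply deriv_within_scal, deriv_within_mult; exact DW|].
        apply deriv_within_scal, deriv_within_mult; [exact DW|exact Dv].
      - match goal with |- Rabs ?G + _ <= _ => replace G with 0 end.
        + rewrite Rabs_R0; unfold k.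
          replace (r t - (r t + -1 * e t)) with (e t) by ring; lra.
        + rewrite (Edv t Ht); unfold Q, phi, chi.
          replace (r t + -1 * e t) with (r t - e t) by ring.
          fold kd kp; field; lra. }
    apply deriv_within_ext with (2 := Ht) (3 := D); intros s _; unfold U.
    replace (r s + -1 * e s) with (r s - e s) by ring; ring.
  - intros EU.
    assert (HQ : m * (e t ^ 2 + v t ^ 2) <= Q).
    (* The increments of [h] are slopes times [e] and [v]. *)
    { destruct (factor_of_le phi (e t) L1) as [be [Hbe Ebe]]; [lra|exact Hphi|].
      destruct (factor_of_le chi (v t) L2) as [th [Hth Eth]]; [lra|exact Hchi|].
      eapply Rle_trans; [apply (Hform th (kp + be) (v t) (e t)); lra|].
      unfold Q; rewrite Ebe, Eth; right; ring. }
    assert (Hp : - phi * dr t + k <= K * Rabs (e t)).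
    { assert (Rabs (- phi * dr t) <= L1 * Rabs (e t) * Rabs (dr t)).
      { apply Rabs_mult_le; [rewrite Rabs_Ropp; exact Hphi|lra]. }
      pose proof (Rle_abs (- phi * dr t)).
      pose proof (Rmult_le_compat_l _ _ _ (Rabs_pos (e t)) (HdK t Ht)).
      unfold k; lra. }
    assert (Hdec := lyapunov_decrease m K kappa mu g kd kp (e t) (v t) (W t) (F t)
      phi chi (- phi * dr t + k) Q Hm HK Ek ltac:(lra) ltac:(lra) Hkd Hkp (HF t Ht)).
    assert (Hphi' : Rabs phi <= K * Rabs (e t)).
    { eapply Rle_trans; [exact Hphi|].
      apply Rmult_le_compat_r; [apply Rabs_pos|lra]. }
    assert (Hchi' : Rabs chi <= K * Rabs (v t)).
    { eapply Rle_trans; [exact Hchi|].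
      apply Rmult_le_compat_r; [apply Rabs_pos|lra]. }
    specialize (Hdec Hphi' Hchi' Hp HQ); fold T in Hdec; fold (N t) in Hdec.
    assert (HN : 10 * K ^ 3 * (T + 1) <= 5 * K ^ 3 * (kappa * N t)).
    { rewrite <- EX; replace X with (g * U t) by (rewrite EU; field; lra).
      pose proof (Rmult_le_compat_r kappa _ _ ltac:(lra) (Hupp t)); lra. }
    assert (2 * (T + 1) <= kappa * N t).
    { apply Rmult_le_reg_l with (5 * K ^ 3); lra. }
    lra. }
intros t Ht; specialize (HU t Ht).
assert (HN : om ^ 2 * N t <= Y).
{ assert (A := Rle_trans _ _ _ (Hlow t) HU).
  apply Rmult_le_reg_r with (kappa * kap); [apply Rmult_lt_0_compat; lra|].
  replace (Y * (kappa * kap)) with (K * X) by (unfold Y; field; lra).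
  apply Rle_trans with (om * X); [|apply Rmult_le_compat_r; unfold kd in *; lra].
  replace (om ^ 2 * N t * (kappa * kap)) with (om * (g * (kappa * N t)))
    by (unfold g; ring).
  apply Rmult_le_compat_l; [lra|].
  apply (Rmult_le_compat_l g) in A; [|lra].
  replace (g * (X / g)) with X in A by (field; lra); exact A. }
pose proof (pow2_ge_0 (e t)); pose proof (pow2_ge_0 (v t)).
pose proof (pow2_ge_0 (W t)).
assert (Hsq : forall x, x ^ 2 <= N t -> om * Rabs x <= 1 + Y).
{ intros x Hx.
  assert ((om * Rabs x) ^ 2 <= Y).
  { rewrite Rpow_mult_distr, pow2_abs.
    apply Rle_trans with (om ^ 2 * N t); [|exact HN].
    apply Rmult_le_compat_l; [apply pow2_ge_0|exact Hx]. }
  nra. }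
assert (Se : om * Rabs (e t) <= 1 + Y) by (apply Hsq; unfold N; lra).
assert (Sv : om * Rabs (v t) <= 1 + Y) by (apply Hsq; unfold N; lra).
assert (SW : om * Rabs (W t) <= 1 + Y) by (apply Hsq; unfold N; lra).
apply Rmult_le_reg_l with om; [exact Ho|].
replace (om * (K * (5 * (1 + Y) + K) / om)) with (K * (5 * (1 + Y) + K))
  by (field; lra).
assert (Hq : Rabs (dv t + kad * v t + kap * e t)
  <= 2 * K * Rabs (v t) + 2 * K * Rabs (e t) + Rabs (W t) + K).
{ rewrite (Edv t Ht); fold kd kp.
  assert (Hh1 := proj1 Hh (r t - e t) (r t) (dr t)).
  assert (Hh2 := proj2 Hh (r t - e t) (dr t - v t) (dr t)).
  replace (r t - e t - r t) with (- e t) in Hh1 by ring.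
  replace (dr t - v t - dr t) with (- v t) in Hh2 by ring.
  rewrite Rabs_Ropp in Hh1, Hh2.
  assert (Hh1' := Rle_trans _ _ _ Hh1
    (Rmult_le_compat_r _ _ _ (Rabs_pos (e t)) HL1K)).
  assert (Hh2' := Rle_trans _ _ _ Hh2
    (Rmult_le_compat_r _ _ _ (Rabs_pos (v t)) HL2K)).
  assert (A1 : Rabs (om * v t) <= K * Rabs (v t)).
  { apply Rabs_mult_le; [rewrite Rabs_right; unfold kd in *|]; lra. }
  assert (A2 : Rabs (kad * om * e t) <= K * Rabs (e t)).
  { assert (0 < kad * om) by (apply Rmult_lt_0_compat; lra).
  apply Rabs_mult_le; [rewrite Rabs_right; unfold kp in *|]; lra. }
  specialize (HF t Ht).
  replace (- kd * v t - kp * e t - W t - F t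
    - (h (r t - e t) (dr t - v t) - h (r t) (dr t)) + kad * v t + kap * e t)
    with (- (om * v t + (kad * om * e t + (W t + (F t
       + ((h (r t - e t) (dr t - v t) - h (r t - e t) (dr t))
          + (h (r t - e t) (dr t) - h (r t) (dr t))))))))
    by (unfold kd, kp; ring).
  rewrite Rabs_Ropp.
  eapply Rle_trans; [apply Rabs_triang|].
  eapply Rle_trans; [apply Rplus_le_compat_l, Rabs_triang|].
  eapply Rle_trans; [do 2 apply Rplus_le_compat_l; apply Rabs_triang|].
  eapply Rle_trans; [do 3 apply Rplus_le_compat_l; apply Rabs_triang|].
  eapply Rle_trans; [do 4 apply Rplus_le_compat_l; apply Rabs_triang|].
  lra. }
apply (Rmult_le_compat_l om) in Hq; [|lra].
apply (Rmult_le_compat_l (2 * K)) in Se; [|lra].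
apply (Rmult_le_compat_l (2 * K)) in Sv; [|lra].
assert (1 * (1 + Y) <= K * (1 + Y)) by (apply Rmult_le_compat_r; lra).
assert (om * K <= K * K) by (apply Rmult_le_compat_r; unfold kd in *; lra).
lra.
Qed.

(** * Large gains *)

(** For large [om] the estimation error [q] is strongly damped, and the tracking
error is a stable filter driven by [q].  Their energies add up to a Lyapunov
function that bounds the state independently of [om]; inserting this bound into
the equation of [q] gives the exponential decay at the exact rate [om]. *)
Lemma high_gain_bound kap kad K q0 : 0 < kap -> 0 < kad -> 1 + kad + kap <= K ->
  exists om1 C, 0 < om1 /\ 0 < C /\
    forall om e v q, om1 <= om ->
      deriv_nonneg e v ->
      deriv_nonneg v (fun t => q t - kad * v t - kap * e t) ->
      (forall t, 0 <= t -> deriv_within q t (- om * q t)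
         (K * (Rabs (e t) + Rabs (v t) + Rabs (q t) + 1))) ->
      e 0 = 0 -> v 0 = 0 -> q 0 = q0 ->
      forall t, 0 <= t -> Rabs (q t) <= Rabs q0 * exp (- om * t) + C / om.
Proof.
intros Hkap Hk HK.
set (a := Rmin (kad / 2) (kad * kap / 2)).
assert (Ha : 0 < a) by (apply Rmin_glb_lt; nra).
assert (Ha1 : a <= kad / 2) by apply Rmin_l.
assert (Ha2 : a <= kad * kap / 2) by apply Rmin_r.
clearbody a.
set (b := Rmin (/ 4) (kap / 2)).
assert (Hb : 0 < b) by (apply Rmin_glb_lt; lra).
assert (Hb1 : b <= / 4) by apply Rmin_l.
assert (Hb2 : b <= kap / 2) by apply Rmin_r.
clearbody b.
set (Z := K ^ 2 / a).
assert (EZ : a * Z = K ^ 2) by (unfold Z; field; lra).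
assert (HZ : 0 < Z) by (apply Rdiv_lt_0_compat; nra).
clearbody Z.
assert (HK2 : 1 <= K ^ 2) by nra.
set (M := q0 ^ 2 / 2 + 2 * K ^ 2 * (Z + 1)).
assert (HM : 0 < M) by (pose proof (pow2_ge_0 q0); unfold M; nra).
set (C := K * (3 * (1 + M / b) + 1)).
assert (HMb : 0 <= M / b) by (apply Rdiv_le_0_compat; lra).
assert (HC : 0 < C) by (unfold C; nra).
exists (4 * Z + K + 1 + a), C; split; [lra|]; split; [exact HC|].
intros om e v q Hom He Hv Hq He0 Hv0 Hq0.
set (U := fun s => / 2 * (v s * v s) + (kad / 2 * (e s * v s)
  + ((kap / 2 + kad ^ 2 / 4) * (e s * e s) + / 2 * (q s * q s)))).
set (N := fun s => e s ^ 2 + v s ^ 2 + q s ^ 2).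
assert (Hlow : forall s, b * N s <= U s).
{ intros s; unfold U, N.
  pose proof (pow2_ge_0 (v s / 2 + kad / 2 * e s)).
  pose proof (pow2_ge_0 (e s)); pose proof (pow2_ge_0 (v s)).
  pose proof (pow2_ge_0 (q s)).
  assert (b * v s ^ 2 <= / 4 * v s ^ 2) by (apply Rmult_le_compat_r; lra).
  assert (b * e s ^ 2 <= kap / 2 * e s ^ 2) by (apply Rmult_le_compat_r; lra).
  assert (b * q s ^ 2 <= / 4 * q s ^ 2) by (apply Rmult_le_compat_r; lra).
  lra. }
assert (Hupp : forall s, U s <= K ^ 2 * N s).
{ intros s; unfold U, N.
  pose proof (pow2_ge_0 (e s)); pose proof (pow2_ge_0 (v s)).
  pose proof (pow2_ge_0 (q s)).
  assert (kad / 4 * (2 * (e s * v s)) <= kad / 4 * (e s ^ 2 + v s ^ 2)).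
  { apply Rmult_le_compat_l; [lra|]; pose proof (pow2_ge_0 (e s - v s)); lra. }
  assert ((kad / 4 + kap / 2 + kad ^ 2 / 4) * e s ^ 2 <= K ^ 2 * e s ^ 2)
    by (apply Rmult_le_compat_r; nra).
  assert ((/ 2 + kad / 4) * v s ^ 2 <= K ^ 2 * v s ^ 2)
    by (apply Rmult_le_compat_r; nra).
  assert (1 * q s ^ 2 <= K ^ 2 * q s ^ 2) by (apply Rmult_le_compat_r; lra).
  lra. }
assert (HU : forall t, 0 <= t -> U t <= M).
{ apply barrier.
  { unfold U, M; rewrite He0, Hv0, Hq0; nra. }
  intros t Ht.
  assert (De := deriv_within_of_deriv _ _ _ He Ht).
  assert (Dv := deriv_within_of_deriv _ _ _ Hv Ht).
  assert (Dq := Hq t Ht).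
  set (G := K * (Rabs (e t) + Rabs (v t) + Rabs (q t) + 1)) in *.
  exists (- (kad / 2) * v t ^ 2 - kad * kap / 2 * e t ^ 2
          + q t * (v t + kad / 2 * e t) - om * q t ^ 2), (Rabs (q t) * G).
  split.
  - eapply deriv_within_weaken.
    + apply deriv_within_plus; [apply deriv_within_scal, deriv_within_mult; exact Dv|].
      apply deriv_within_plus;
        [apply deriv_within_scal, deriv_within_mult; [exact De|exact Dv]|].
      apply deriv_within_plus; [apply deriv_within_scal, deriv_within_mult; exact De|].
      apply deriv_within_scal, deriv_within_mult; exact Dq.
    + match goal with |- Rabs ?G + _ <= _ => replace G with 0 by field end.
      rewrite Rabs_R0, (Rabs_right (/ 2)) by lra; lra.
  - intros EU.
    assert (Pe := Rabs_pos (e t)); assert (Pv := Rabs_pos (v t)).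
    assert (Pq := Rabs_pos (q t)).
    assert (A1 : q t * (v t + kad / 2 * e t)
                  <= Rabs (q t) * (K * (Rabs (e t) + Rabs (v t)))).
    { eapply Rle_trans; [apply Rle_abs|]; apply Rabs_mult_le; [lra|].
      eapply Rle_trans; [apply Rabs_triang|].
      rewrite Rabs_mult, (Rabs_right (kad / 2)) by lra.
      assert (kad / 2 * Rabs (e t) <= K * Rabs (e t)) by (apply Rmult_le_compat_r; lra).
      assert (1 * Rabs (v t) <= K * Rabs (v t)) by (apply Rmult_le_compat_r; lra).
      lra. }
    (* The coupling is split between the tracking energy and the gain. *)
    assert (Young : forall x, 2 * K * (Rabs (q t) * x)
        <= a / 2 * x ^ 2 + 2 * Z * q t ^ 2).
    { intros x; apply Rmult_le_reg_l with (2 * a); [lra|].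
      replace (2 * a * (a / 2 * x ^ 2 + 2 * Z * q t ^ 2))
        with ((a * x) ^ 2 + 4 * (a * Z) * q t ^ 2) by field.
      rewrite EZ, <- (pow2_abs (q t)).
      pose proof (pow2_ge_0 (a * x - 2 * K * Rabs (q t))); lra. }
    pose proof (Young (Rabs (e t))) as Ye; pose proof (Young (Rabs (v t))) as Yv.
    rewrite pow2_abs in Ye, Yv.
    assert (A2 : K * Rabs (q t) <= q t ^ 2 + K ^ 2).
    { rewrite <- (pow2_abs (q t)); pose proof (pow2_ge_0 (Rabs (q t) - K / 2)).
      nra. }
    assert (A3 : Rabs (q t) * (K * Rabs (q t)) = K * q t ^ 2).
    { rewrite <- (pow2_abs (q t)); ring. }
    pose proof (pow2_ge_0 (e t)); pose proof (pow2_ge_0 (v t)).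
    pose proof (pow2_ge_0 (q t)).
    assert (A4 : (4 * Z + K + 1 + a) * q t ^ 2 <= om * q t ^ 2)
      by (apply Rmult_le_compat_r; lra).
    assert (A5 : a * v t ^ 2 <= kad / 2 * v t ^ 2) by (apply Rmult_le_compat_r; lra).
    assert (A6 : a * e t ^ 2 <= kad * kap / 2 * e t ^ 2)
      by (apply Rmult_le_compat_r; lra).
    assert (HN : 2 * (Z + 1) <= N t).
    { apply Rmult_le_reg_l with (K ^ 2); [lra|].
      assert (A := Hupp t); rewrite EU in A; unfold M in A.
      pose proof (pow2_ge_0 q0); lra. }
    assert (HaN : a / 2 * (2 * (Z + 1)) <= a / 2 * N t)
      by (apply Rmult_le_compat_l; lra).
    assert (0 <= a * q t ^ 2) by (apply Rmult_le_pos; lra).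
    unfold N, G in *; lra. }
assert (HN : forall t, 0 <= t -> N t <= M / b).
{ intros t Ht; apply Rmult_le_reg_l with b; [exact Hb|].
  replace (b * (M / b)) with M by (field; lra).
  eapply Rle_trans; [apply Hlow|now apply HU]. }
rewrite <- Hq0; apply decay; [lra|lra|].
intros t Ht; eapply deriv_within_weaken; [apply Hq; exact Ht|].
rewrite Rminus_diag, Rabs_R0, Rplus_0_l; unfold C.
apply Rmult_le_compat_l; [lra|].
assert (Hsq : forall x, x ^ 2 <= N t -> Rabs x <= 1 + M / b).
{ intros x Hx; specialize (HN t Ht); rewrite <- pow2_abs in Hx; nra. }
pose proof (pow2_ge_0 (e t)); pose proof (pow2_ge_0 (v t)).
pose proof (pow2_ge_0 (q t)).
assert (Rabs (e t) <= 1 + M / b) by (apply Hsq; unfold N; lra).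
assert (Rabs (v t) <= 1 + M / b) by (apply Hsq; unfold N; lra).
assert (Rabs (q t) <= 1 + M / b) by (apply Hsq; unfold N; lra).
lra.
Qed.

(** * Boundedness of the transient process *)

(** [(s + cr)^2] factors, so [p = dr + cr * r] and [r] solve first order filters one
after the other. *)
Lemma transient_bounded cr y x10 x20 r dr ddr :
  0 < cr -> reference_signal y -> transient_process cr y x10 x20 r dr ddr ->
  exists B, forall t, 0 <= t ->
    Rabs (r t - r 0) <= B /\ Rabs (dr t) <= B /\ Rabs (ddr t) <= B.
Proof.
intros Hcr [[My HMy] _] [Hr Hdr Hf _ _].
assert (HM0 : 0 <= My)
  by (pose proof (HMy 0 (Rle_refl 0)); pose proof (Rabs_pos (y 0)); lra).
set (p := fun t => dr t + cr * r t).
assert (E : forall t, 0 <= t -> exp (- cr * t) <= 1).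
{ intros t Ht; rewrite <- exp_0.
  destruct (Req_dec t 0) as [->|Hne]; [rewrite Rmult_0_r; lra|].
  left; apply exp_increasing; nra. }
assert (Hfirst : forall g c, 0 <= c ->
  (forall t, 0 <= t -> deriv_within g t (- cr * g t) c) ->
  forall t, 0 <= t -> Rabs (g t) <= Rabs (g 0) + c / cr).
{ intros g c Hc Hg t Ht.
  pose proof (decay g cr c Hcr Hc Hg t Ht); pose proof (E t Ht).
  pose proof (Rabs_pos (g 0)); nra. }
set (Bp := Rabs (p 0) + cr ^ 2 * My / cr).
assert (Hp : forall t, 0 <= t -> Rabs (p t) <= Bp).
{ apply Hfirst; [nra|]; intros t Ht.
  eapply deriv_within_weaken.
  - apply deriv_within_plus; [apply (deriv_within_of_deriv _ _ _ Hdr Ht)|].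
    apply deriv_within_scal, (deriv_within_of_deriv _ _ _ Hr Ht).
  - rewrite (Hf t Ht); unfold p.
    replace (- 2 * cr * dr t - cr ^ 2 * (r t - y t) + cr * dr t
             - - cr * (dr t + cr * r t)) with (cr ^ 2 * y t) by ring.
    rewrite Rabs_mult, (Rabs_right (cr ^ 2)) by nra.
    pose proof (HMy t Ht); nra. }
set (Br := Rabs (r 0) + Bp / cr).
assert (Hrb : forall t, 0 <= t -> Rabs (r t) <= Br).
{ apply Hfirst.
  { pose proof (Hp 0 (Rle_refl 0)); pose proof (Rabs_pos (p 0)); lra. }
  intros t Ht; eapply deriv_within_weaken; [apply (deriv_within_of_deriv _ _ _ Hr Ht)|].
  replace (dr t - - cr * r t) with (p t) by (unfold p; ring).
  pose proof (Hp t Ht); lra. }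
set (Bd := Bp + cr * Br).
assert (Hd : forall t, 0 <= t -> Rabs (dr t) <= Bd).
{ intros t Ht; replace (dr t) with (p t + - (cr * r t)) by (unfold p; ring).
  eapply Rle_trans; [apply Rabs_triang|].
  rewrite Rabs_Ropp, Rabs_mult, (Rabs_right cr) by lra.
  pose proof (Hp t Ht); pose proof (Hrb t Ht); unfold Bd; nra. }
set (Bdd := 2 * cr * Bd + cr ^ 2 * (Br + My)).
assert (Hdd : forall t, 0 <= t -> Rabs (ddr t) <= Bdd).
{ intros t Ht; rewrite (Hf t Ht).
  replace (- 2 * cr * dr t - cr ^ 2 * (r t - y t))
    with (- (2 * cr * dr t) + cr ^ 2 * (y t + - r t)) by ring.
  eapply Rle_trans; [apply Rabs_triang|].
  rewrite Rabs_Ropp, !Rabs_mult, (Rabs_right cr), (Rabs_right 2),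
    (Rabs_right (cr ^ 2)) by nra.
  pose proof (Rabs_triang (y t) (- r t)) as Ht'; rewrite Rabs_Ropp in Ht'.
  pose proof (Hd t Ht); pose proof (Hrb t Ht); pose proof (HMy t Ht).
  unfold Bdd; apply Rplus_le_compat; apply Rmult_le_compat_l; nra. }
exists (2 * Br + Bd + Bdd); intros t Ht.
pose proof (Hd t Ht); pose proof (Hrb t Ht); pose proof (Hdd t Ht).
pose proof (Hrb 0 (Rle_refl 0)).
pose proof (Rabs_pos (r t)); pose proof (Rabs_pos (dr t)); pose proof (Rabs_pos (ddr t)).
pose proof (Rabs_triang (r t) (- r 0)) as Ht'; rewrite Rabs_Ropp in Ht'.
unfold Rminus; repeat split; lra.
Qed.

(** The constants of the theorem may depend on [dr] and [ddr], but not on the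
filter and the reference that produced them.  One such pair gives the bounds,
and all [r] with derivative [dr] differ by a constant. *)
Lemma transient_bounded_uniform dr ddr :
  exists B, 0 <= B /\ forall cr y x10 x20 r,
    0 < cr -> reference_signal y -> transient_process cr y x10 x20 r dr ddr ->
    forall t, 0 <= t -> Rabs (r t - r 0) <= B /\ Rabs (dr t) <= B /\ Rabs (ddr t) <= B.
Proof.
destruct (classic (exists cr y x10 x20 r, 0 < cr /\ reference_signal y /\
  transient_process cr y x10 x20 r dr ddr)) as [[cr [y [x10 [x20 [r1 [Hcr [Hy Htp]]]]]]]|Hno].
- destruct (transient_bounded cr y x10 x20 r1 dr ddr Hcr Hy Htp) as [B HB].
  exists B; split.
  { destruct (HB 0 (Rle_refl 0)) as [_ [A _]]; pose proof (Rabs_pos (dr 0)); lra. }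
  intros cr' y' x10' x20' r _ _ Htp' t Ht.
  assert (Hsame : forall f g, deriv_nonneg f dr -> deriv_nonneg g dr ->
                    f t - f 0 <= g t - g 0).
  { intros f g Hf Hg.
    enough (f t - g t <= f 0 - g 0) by lra.
    apply (nonincreasing_of_deriv_nonpos (fun s => f s - g s) (fun s => dr s - dr s));
      [|intros; lra|exact Ht].
    intros s Hs; exact (Dminus _ _ _ _ _ _ (Hf s Hs) (Hg s Hs)). }
  assert (H1 := Hsame r r1 (tp_dr _ _ _ _ _ _ _ Htp') (tp_dr _ _ _ _ _ _ _ Htp)).
  assert (H2 := Hsame r1 r (tp_dr _ _ _ _ _ _ _ Htp) (tp_dr _ _ _ _ _ _ _ Htp')).
  destruct (HB t Ht) as [A1 A2]; split; [|exact A2].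
  replace (r t - r 0) with (r1 t - r1 0) by lra; exact A1.
- exists 0; split; [lra|]; intros cr y x10 x20 r Hcr Hy Htp; exfalso; apply Hno.
  now exists cr, y, x10, x20, r.
Qed.

(** * The closed loop *)

Theorem theorem2 :
  forall (L1 L2 L3 kap kad : R),
    0 < L1 -> 0 < L2 -> 0 < L3 -> 0 < kap -> 0 < kad ->
  forall (ef0 : R) (dr ddr : R -> R),
  exists eta1 eta2 : R,
    0 < eta1 /\ 0 < eta2 /\
    forall (f : R -> R -> R -> R) (cr : R) (ystar r : R -> R) (x10 x20 : R),
      class_F L1 L2 L3 f ->
      0 < cr ->
      reference_signal ystar ->
      transient_process cr ystar x10 x20 r dr ddr ->
    forall om : R, omega_star L1 L2 kap kad < om ->
    forall x1 x2 xi : R -> R,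
      x1 0 = x10 -> x2 0 = x20 ->
      closed_loop f om kap kad r dr ddr x1 x2 xi ->
      err_f f om x1 x2 xi 0 = ef0 ->
    exists de dde : R -> R,
      deriv_nonneg (err r x1) de /\ deriv_nonneg de dde /\
      forall t : R, 0 <= t ->
        Rabs (dde t + kad * de t + kap * err r x1 t)
          = Rabs (err_f f om x1 x2 xi t) /\
        Rabs (err_f f om x1 x2 xi t) <= eta1 * exp (- om * t) + eta2 / om.
Proof.
intros L1 L2 L3 kap kad HL1 HL2 HL3 Hkap Hkad ef0 dr ddr.
destruct (transient_bounded_uniform dr ddr) as [B [HB Href]].
(* [K1] bounds the rate of change of the uncertainty along the trajectory,
   relative to the size of the state. *)
set (K1 := 1 + kad + kap + L1 * (1 + B) + L2 * (1 + B + kad + kap) + L3).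
assert (P1 : 0 <= L1 * (1 + B)) by nra.
assert (P2 : 0 <= L2 * (1 + B + kad + kap)) by nra.
destruct (high_gain_bound kap kad K1 ef0 Hkap Hkad) as [om1 [C1 [Hom1 [HC1 Hhigh]]]].
{ unfold K1; lra. }
(* [K2] bounds the loop gains up to [om1] and the forcing along the reference. *)
set (K2 := 1 + L1 + L2 + om1 + kad + kad * om1 + kap + kap * om1
           + 2 * (L1 + L2) * B + Rabs ef0 + 2 * L3).
assert (Pe := Rabs_pos ef0).
assert (P3 : 0 < kad * om1) by nra.
assert (P4 : 0 < kap * om1) by nra.
assert (P5 : 0 <= L1 * B) by nra.
assert (P6 : 0 <= L2 * B) by nra.
destruct (moderate_gain_bound L1 L2 kap kad K2 HL1 HL2 Hkap Hkad)
  as [C2 [HC2 Hmod]]; try (unfold K2; lra).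
exists (Rabs ef0 + 1), (C1 + C2); split; [lra|]; split; [lra|].
intros f cr ystar r x10 x20 Hf Hcr Hy Htp om Hom x1 x2 xi Hx1 Hx2 Hcl Hef0.
destruct (class_F_lipschitz L1 L2 L3 f Hf) as [h [w [dw [Hh [Efw [Hw [Hdw Hdwb]]]]]]].
assert (Hbd := Href cr ystar x10 x20 r Hcr Hy Htp).
destruct Htp as [Hr Hdr _ Hr0 Hdr0].
destruct Hcl as [Cx1 Cx2 Cxi Cxi0].
assert (Ho : 0 < om).
{ destruct (omega_star_nonneg L1 L2 kap kad Hkad) as [A _]; lra. }
set (e := err r x1); set (v := fun s => dr s - x2 s).
set (q := err_f f om x1 x2 xi).
set (dv := fun s => q s - kad * v s - kap * e s).
assert (He : deriv_nonneg e v).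
{ intros t Ht; apply Dminus; [apply Hr|apply Cx1]; exact Ht. }
assert (Hv : deriv_nonneg v dv).
{ intros t Ht; assert (D := Dminus _ _ _ _ _ _ (Hdr t Ht) (Cx2 t Ht)).
  unfold D_in in *; cbv beta in D.
  replace (dv t) with
    (ddr t - (f (x1 t) (x2 t) t + control om kap kad r dr ddr x1 x2 xi t)); [exact D|].
  unfold dv, q, v, e, err_f, control, err; ring. }
assert (Hfh : deriv_nonneg (f_hat om x2 xi) (fun t => - om * q t)).
{ intros t Ht; assert (D := Dadd _ _ _ _ _ _ (Cxi t Ht)
                              (Dmult_const _ _ _ _ om (Cx2 t Ht))).
  unfold D_in in *; cbv beta in D.
  match type of D with limit1_in _ _ ?l _ => replace (- om * q t) with l end;
    [exact D|].
  unfold q, err_f, f_hat; ring. }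
assert (He0 : e 0 = 0) by (unfold e, err; rewrite Hr0, Hx1; ring).
assert (Hv0 : v 0 = 0) by (unfold v; rewrite Hdr0, Hx2; ring).
assert (Hfh0 : f_hat om x2 xi 0 = 0) by (unfold f_hat; rewrite Cxi0; ring).
assert (Hq : forall s, 0 <= s -> q s = f_hat om x2 xi s - h (x1 s) (x2 s) - w s).
{ intros s Hs; unfold q, err_f; rewrite Efw by exact Hs; ring. }
exists v, dv; split; [exact He|]; split; [exact Hv|].
intros t Ht; split; [unfold dv; f_equal; fold e; ring|].
fold q; assert (Pexp := exp_pos (- om * t)).
assert (H1 : 0 < C1 / om) by now apply Rdiv_lt_0_compat.
assert (H2 : 0 < C2 / om) by now apply Rdiv_lt_0_compat.
replace ((C1 + C2) / om) with (C1 / om + C2 / om) by (field; lra).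
destruct (Rle_dec om1 om) as [Hlarge|Hsmall].
- enough (Rabs (q t) <= Rabs ef0 * exp (- om * t) + C1 / om) by nra.
  apply (Hhigh om e v q); try assumption.
  clear t Ht Pexp; intros t Ht.
  destruct (Hbd t Ht) as [_ [Hb1 Hb2]].
  apply deriv_within_ext with
    (fun s => f_hat om x2 xi s + (-1 * h (x1 s) (x2 s) + -1 * w s));
    [intros s Hs; rewrite Hq by exact Hs; ring|exact Ht|].
  eapply deriv_within_weaken.
  + apply deriv_within_plus; [apply (deriv_within_of_deriv _ _ _ Hfh Ht)|].
    apply deriv_within_plus; apply deriv_within_scal;
      [|apply (deriv_within_of_deriv _ _ _ Hdw Ht)].
    apply (deriv_within_lipschitz2 h L1 L2); [lra|lra|exact Hh| |];
      [apply (deriv_within_of_deriv _ _ _ Cx1 Ht)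
      |apply (deriv_within_of_deriv _ _ _ Cx2 Ht)].
  + match goal with |- Rabs ?G + _ <= _ => replace G with (- dw t) by ring end.
    rewrite Rabs_Ropp; replace (Rabs (-1)) with 1 by (rewrite Rabs_left; lra).
    specialize (Hdwb t Ht).
    assert (X2 : Rabs (x2 t) <= B + Rabs (v t)).
    { replace (x2 t) with (dr t + - v t) by (unfold v; ring).
      eapply Rle_trans; [apply Rabs_triang|]; rewrite Rabs_Ropp; lra. }
    set (d2 := f (x1 t) (x2 t) t + control om kap kad r dr ddr x1 x2 xi t).
    assert (D2 : Rabs d2 <= B + Rabs (q t) + kad * Rabs (v t) + kap * Rabs (e t)).
    { replace d2 with (ddr t + (- q t + (kad * v t + kap * e t)))
        by (unfold d2, q, v, e, err_f, control, err; ring).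
      eapply Rle_trans; [apply Rabs_triang|].
      eapply Rle_trans; [apply Rplus_le_compat_l, Rabs_triang|].
      eapply Rle_trans; [do 2 apply Rplus_le_compat_l; apply Rabs_triang|].
      rewrite Rabs_Ropp, !Rabs_mult, (Rabs_right kad), (Rabs_right kap) by lra; lra. }
    apply (Rmult_le_compat_l L1) in X2; [|lra].
    apply (Rmult_le_compat_l L2) in D2; [|lra].
    assert (Pe' := Rabs_pos (e t)); assert (Pv := Rabs_pos (v t)).
    assert (Pq := Rabs_pos (q t)).
    set (S := Rabs (e t) + Rabs (v t) + Rabs (q t) + 1).
    assert (S1 : L1 * (B + Rabs (v t)) <= L1 * ((1 + B) * S)).
    { apply Rmult_le_compat_l; unfold S; nra. }
    assert (S2 : L2 * (B + Rabs (q t) + kad * Rabs (v t) + kap * Rabs (e t))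
                 <= L2 * ((1 + B + kad + kap) * S)).
    { apply Rmult_le_compat_l; unfold S; nra. }
    assert (S3 : 1 <= S) by (unfold S; lra).
    assert (S4 : 0 <= (1 + kad + kap) * S) by nra.
    assert (S5 : L3 <= L3 * S) by nra.
    unfold K1; lra.
- enough (Rabs (q t) <= C2 / om) by nra.
  assert (Q : dv t + kad * v t + kap * e t = q t) by (unfold dv; ring).
  rewrite <- Q.
  (* Integrating the observer gives [f_hat = - om * (v + kad * e) - W], where [W]
     is the integral of [kap * om * e]. *)
  set (W := fun s => - (f_hat om x2 xi s + (om * v s + om * kad * e s))).
  set (F := fun s => h (r s) (dr s) + w s).
  apply (Hmod om h r dr ddr e v dv W F); try assumption.
  + unfold K2; lra.
  + unfold K2; assert (kad * om <= kad * om1) by (apply Rmult_le_compat_l; lra); lra.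
  + unfold K2; assert (kap * om <= kap * om1) by (apply Rmult_le_compat_l; lra); lra.
  + intros s Hs; destruct (Hbd s Hs) as [_ [Hb1 Hb2]].
    apply (Rmult_le_compat_l L1) in Hb1; [|lra].
    apply (Rmult_le_compat_l L2) in Hb2; [|lra]; unfold K2; lra.
  + intros s Hs; unfold F.
    (* The initial estimate is [0], so the forcing starts at [- ef0]. *)
    assert (EF0 : h (r 0) (dr 0) + w 0 = - ef0).
    { assert (A := Hq 0 (Rle_refl 0)); fold q in Hef0.
      rewrite Hef0, Hfh0, Hx1, Hx2 in A; rewrite Hr0, Hdr0; lra. }
    destruct (Hbd s Hs) as [Hb0 [Hb1 _]].
    destruct (Hbd 0 (Rle_refl 0)) as [_ [Hb2 _]].
    assert (Hw1 := Hw s Hs); assert (Hw2 := Hw 0 (Rle_refl 0)).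
    assert (A1 := proj1 Hh (r s) (r 0) (dr s)).
    assert (A2 := proj2 Hh (r 0) (dr s) (dr 0)).
    assert (A3 : Rabs (dr s - dr 0) <= 2 * B).
    { eapply Rle_trans; [apply Rabs_triang|]; rewrite Rabs_Ropp; lra. }
    apply (Rmult_le_compat_l L1) in Hb0; [|lra].
    apply (Rmult_le_compat_l L2) in A3; [|lra].
    replace (h (r s) (dr s) + w s)
      with (- ef0 + ((h (r s) (dr s) - h (r 0) (dr s))
             + ((h (r 0) (dr s) - h (r 0) (dr 0)) + (w s + - w 0))))
      by (rewrite <- EF0; ring).
    eapply Rle_trans; [apply Rabs_triang|].
    eapply Rle_trans; [apply Rplus_le_compat_l, Rabs_triang|].
    eapply Rle_trans; [do 2 apply Rplus_le_compat_l; apply Rabs_triang|].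
    eapply Rle_trans; [do 3 apply Rplus_le_compat_l; apply Rabs_triang|].
    rewrite !Rabs_Ropp; unfold K2; lra.
  + intros s Hs.
    assert (D := Dopp _ _ _ _ (Dadd _ _ _ _ _ _ (Hfh s Hs)
      (Dadd _ _ _ _ _ _ (Dmult_const _ _ _ _ om (Hv s Hs))
        (Dmult_const _ _ _ _ (om * kad) (He s Hs))))).
    unfold D_in in *; cbv beta in D.
    match type of D with limit1_in _ _ ?l _ => replace (kap * om * e s) with l end;
      [exact D|].
    unfold dv; ring.
  + intros s Hs; unfold F, W, dv; rewrite Hq by exact Hs.
    replace (r s - e s) with (x1 s) by (unfold e, err; ring).
    replace (dr s - v s) with (x2 s) by (unfold v; ring); ring.
  + unfold W; rewrite He0, Hv0, Hfh0; ring.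
Qed.
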